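(* Let $d\ge 1$ and $n\ge 1$ be integers. For all $f,g\in\mathcal{H}_n:=\mathrm{span}\{\phi_{\mathbf k}:\mathbf k\in\mathbb{H}_n\}$, $$\langle f,g\rangle=\langle f,g\rangle_n=\langle f,g\rangle_n^*,$$ where $$\langle f,g\rangle=\frac1{\sqrt{d+1}}\int_{\Omega_H}f(\mathbf t)\overline{g(\mathbf t)}\,d\mathbf t,\qquad \langle f,g\rangle_n=\frac{1}{(d+1)n^d}\sum_{\mathbf j\in\mathbb{H}_n}f\big(\tfrac{\mathbf j}{(d+1)n}\big)\overline{g\big(\tfrac{\mathbf j}{(d+1)n}\big)},$$ $$\langle f,g\rangle_n^*=\frac{1}{(d+1)n^d}\sum_{\mathbf j\in\mathbb{H}_n^*}c_{\mathbf j}^{(n)}f\big(\tfrac{\mathbf j}{(d+1)n}\big)\overline{g\big(\tfrac{\mathbf j}{(d+1)n}\big)}.$$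
   Context: Let $\mathbb{R}_H^{d+1}=\{\mathbf t\in\mathbb{R}^{d+1}:t_1+\cdots+t_{d+1}=0\}$, equipped with $d$-dimensional Lebesgue (surface) measure $d\mathbf t$, and $$\Omega_H=\{\mathbf t\in\mathbb{R}_H^{d+1}:-1<t_i-t_j\le 1,\ 1\le i<j\le d+1\},$$ which has measure $\sqrt{d+1}$. Let $\mathbb{H}=\{\mathbf k\in\mathbb{Z}^{d+1}:k_1+\cdots+k_{d+1}=0,\ k_1\equiv k_2\equiv\cdots\equiv k_{d+1}\ (\mathrm{mod}\ d+1)\}$ and, for $\mathbf k\in\mathbb{H}$, $\phi_{\mathbf k}(\mathbf t)=e^{\frac{2\pi i}{d+1}\mathbf k\cdot\mathbf t}$. Define $$\mathbb{H}_n=\{\mathbf k\in\mathbb{H}:-n<\tfrac{k_i-k_j}{d+1}\le n,\ 1\le i<j\le d+1\},\quad \mathbb{H}_n^*=\{\mathbf k\in\mathbb{H}:-n\le\tfrac{k_i-k_j}{d+1}\le n,\ 1\le i<j\le d+1\},$$ $$\mathbb{H}_n^\circ=\{\mathbf k\in\mathbb{H}:-n<\tfrac{k_i-k_j}{d+1}<n,\ 1\le i<j\le d+1\}.$$ For nonempty disjoint $I,J\subset\{1,\dots,d+1\}$ let $$B_{I,J}=\{\mathbf t\in\mathbb{R}_H^{d+1}:t_i>t_l>t_j=t_i-1\ \text{for all } i\in I,\ j\in J,\ l\notin I\cup J\}$$ (when $I\cup J=\{1,\dots,d+1\}$ the condition is just $t_j=t_i-1$ for all $i\in I$, $j\in J$).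 For $i,j\ge1$ with $i+j\le d+1$ let $\mathbb{H}_n^{i,j}$ be the set of $\mathbf k\in\mathbb{H}$ such that $\frac{\mathbf k}{(d+1)n}\in B_{I,J}$ for some disjoint $I,J$ with $|I|=i$, $|J|=j$; these sets are pairwise disjoint with union $\mathbb{H}_n^*\setminus\mathbb{H}_n^\circ$. The weights are $c_{\mathbf k}^{(n)}=1$ if $\mathbf k\in\mathbb{H}_n^\circ$ and $c_{\mathbf k}^{(n)}=1/\binom{i+j}{i}$ if $\mathbf k\in\mathbb{H}_n^{i,j}$. *)

(* Defs.v *)
From HB Require Import structures.
From mathcomp Require Import all_boot all_order all_algebra.
From mathcomp Require Import all_classical all_reals all_analysis measurable_realfun.
From mathcomp Require Import zify.
From mathcomp.real_closed Require Import complex.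

Set Implicit Arguments.
Unset Strict Implicit.
Unset Printing Implicit Defensive.

Import Order.TTheory GRing.Theory Num.Theory.
Import numFieldNormedType.Exports.

Local Open Scope classical_set_scope.
Local Open Scope complex_scope.
Local Open Scope ring_scope.

Notation Rn R n := (n.-tuple (measurableTypeR R)).

Section lebesgue_tuple.
Variable R : realType.

Section cons.
Variable n : nat.

Definition cons_pair (p : measurableTypeR R * Rn R n) : Rn R n.+1 :=
  [tuple of p.1 :: p.2].

Definition uncons_pair (t : Rn R n.+1) : measurableTypeR R * Rn R n :=
  (thead t, [tuple of behead t]).

Lemma cons_pairK : cancel cons_pair uncons_pair.
Proof.
move=> [x t]; rewrite /uncons_pair /cons_pair /= theadE; congr pair.
exact/val_inj.
Qed.

Lemma uncons_pairK : cancel uncons_pair cons_pair.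
Proof. by move=> t; rewrite /cons_pair /= [RHS]tuple_eta. Qed.

Lemma measurable_cons_pair : measurable_fun [set: _] cons_pair.
Proof. exact: measurable_cons. Qed.

Lemma measurable_uncons_pair : measurable_fun [set: _] uncons_pair.
Proof.
by apply/measurable_fun_pair; [exact: measurable_tnth|exact: measurable_behead].
Qed.

Variable mu : {sigma_finite_measure set (Rn R n) -> \bar R}.

Definition lebesgue_cons : set (Rn R n.+1) -> \bar R :=
  pushforward (lebesgue_measure \x mu)%E cons_pair.

HB.instance Definition _ := Measure.copy lebesgue_cons
  (measure_function_pushforward__canonical__measure_function_Measure
    (lebesgue_measure \x mu)%E measurable_cons_pair).

Let lebesgue_cons_sigma_finite : sigma_finite setT lebesgue_cons.
Proof.
have /sigma_finiteP[F [TF ndF Foo]] := sigma_finiteT (@lebesgue_measure R).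
have /sigma_finiteP[G [TG ndG Goo]] := sigma_finiteT mu.
exists (fun k => uncons_pair @^-1` (F k `*` G k)).
  rewrite -preimage_bigcup -[LHS](preimage_setT uncons_pair); congr preimage.
  rewrite -setXTT TF TG predeqE => -[x y]; split.
    move=> [/= [k _ Fkx] [l _ Gly]]; exists (maxn k l) => //; split.
    - by move: x Fkx; exact/subsetPset/ndF/leq_maxl.
    - by move: y Gly; exact/subsetPset/ndG/leq_maxr.
  by move=> [k _ []/= ? ?]; split; exists k.
move=> k; have [? ?] := Foo k; have [? ?] := Goo k; split.
  rewrite -[X in measurable X]setTI.
  by apply: measurable_uncons_pair => //; exact: measurableX.
rewrite /lebesgue_cons /pushforward -comp_preimage.
rewrite (_ : uncons_pair \o cons_pair = id) ?preimage_id.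
  by rewrite product_measure1E// lte_mul_pinfty// ge0_fin_numE.
by apply/funext => p /=; rewrite cons_pairK.
Qed.

HB.instance Definition _ := Measure_isSigmaFinite.Build _ _ _ lebesgue_cons
  lebesgue_cons_sigma_finite.

End cons.

Fixpoint lebesgue_tuple n : {sigma_finite_measure set (Rn R n) -> \bar R} :=
  match n with
  | 0 => @dirac _ (Rn R 0) [tuple] R
  | m.+1 => lebesgue_cons (lebesgue_tuple m)
  end.

End lebesgue_tuple.

Section hyperplane.
Variables (R : realType) (d : nat).

Definition RH : set (Rn R d.+1) := [set t | \sum_(i < d.+1) tnth t i = 0].

(* The rows e_i - e_(d+1), for 1 <= i <= d, form a basis of the hyperplane. *)
Definition RH_basis : 'M[R]_(d, d.+1) :=
  \matrix_(i, j) ((j == widen_ord (leqnSn d) i)%:R - (j == ord_max)%:R).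

Definition RH_param (s : Rn R d) : Rn R d.+1 :=
  [tuple \sum_(i < d) tnth s i * RH_basis i j | j < d.+1].

Lemma measurable_RH_param : measurable_fun [set: _] RH_param.
Proof.
apply/measurable_fun_tnthP => j.
rewrite (_ : _ \o _ = fun s => \sum_(i < d) tnth s i * RH_basis i j); last first.
  by apply/funext => s /=; rewrite tnth_mktuple.
apply: measurable_sum => i; apply: measurable_funM => //.
exact: measurable_tnth.
Qed.

Lemma RH_paramE (s : Rn R d) :
  (forall i, tnth (RH_param s) (widen_ord (leqnSn d) i) = tnth s i) /\
  tnth (RH_param s) ord_max = - \sum_(i < d) tnth s i.
Proof.
split=> [i|]; rewrite tnth_mktuple.
  rewrite (bigD1 i)//= big1 => [|k ki]; rewrite mxE -!val_eqE/= (ltn_eqF (ltn_ord i)) subr0.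
    by rewrite eqxx mulr1 addr0.
  by rewrite eq_sym (negbTE ki : (k == i :> nat) = false) mulr0.
rewrite -sumrN; apply: eq_bigr => i _; rewrite mxE eqxx.
by rewrite -val_eqE /= (gtn_eqF (ltn_ord i)) sub0r mulrN1.
Qed.

Lemma range_RH_param : range RH_param = RH.
Proof.
apply/seteqP; split=> [_ [s _ <-]|t tH].
  have [sE sm] := RH_paramE s.
  rewrite /RH /= big_ord_recr /= sm; apply/eqP; rewrite subr_eq0; apply/eqP.
  by apply: eq_bigr => i _; rewrite sE.
exists [tuple tnth t (widen_ord (leqnSn d) i) | i < d] => //.
set s := [tuple _ | i < d]; have [sE sm] := RH_paramE s.
apply: eq_from_tnth => j; have [jd|dj] := ltnP j d.
  rewrite (_ : j = widen_ord (leqnSn d) (Ordinal jd)); last exact: val_inj.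
  by rewrite sE tnth_mktuple.
have -> : j = ord_max.
  by apply/val_inj/eqP; rewrite eqn_leq dj andbT -ltnS ltn_ord.
move: tH; rewrite /RH /= big_ord_recr /= sm => /eqP; rewrite addrC addr_eq0.
move=> /eqP ->; congr (- _).
by apply: eq_bigr => i _; rewrite tnth_mktuple.
Qed.

(* The d-dimensional Lebesgue measure of a parallelotope is the square root of *)
(* the Gram determinant of the vectors that span it.                           *)
Definition RH_gram : R := Num.sqrt (\det (RH_basis *m RH_basis^T)).

Let RH_gram_ge0 : 0 <= RH_gram. Proof. exact: sqrtr_ge0. Qed.

Let lebesgue_param : {measure set (Rn R d.+1) -> \bar R} :=
  measure_function_pushforward__canonical__measure_function_Measure
    (lebesgue_tuple R d) measurable_RH_param.

(* surface measure on the hyperplane, as a measure on the ambient space *)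
Definition surface : set (Rn R d.+1) -> \bar R :=
  mscale (NngNum RH_gram_ge0) lebesgue_param.

HB.instance Definition _ := Measure.on surface.

End hyperplane.
Arguments RH : clear implicits.
Arguments surface : clear implicits.

Section integral.
Context {dT : measure_display} {T : measurableType dT} {R : realType}.

Definition cintegral (mu : {measure set T -> \bar R}) (D : set T)
    (F : T -> R[i]) : R[i] :=
  Rintegral mu D (fun t => complex.Re (F t)) +i*
  Rintegral mu D (fun t => complex.Im (F t)).

End integral.

Section lattice.
Variables (R : realType) (d n : nat).
Implicit Types (k : d.+1.-tuple int) (t : Rn R d.+1) (f g : Rn R d.+1 -> R[i]).

Definition OmegaH : set (Rn R d.+1) :=
  [set t | RH R d t /\
    forall i j : 'I_d.+1, (i < j)%N -> -1 < tnth t i - tnth t j <= 1].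

Definition HH : set (d.+1.-tuple int) :=
  [set k | \sum_(i < d.+1) tnth k i = 0 /\
    forall i j, (tnth k i = tnth k j %[mod d.+1])%Z].

Definition kdiff k (i j : 'I_d.+1) : R :=
  (tnth k i - tnth k j)%:~R / d.+1%:R.

Definition HHn : set (d.+1.-tuple int) :=
  [set k | HH k /\
    forall i j : 'I_d.+1, (i < j)%N -> - n%:R < kdiff k i j <= n%:R].

Definition HHstar : set (d.+1.-tuple int) :=
  [set k | HH k /\
    forall i j : 'I_d.+1, (i < j)%N -> - n%:R <= kdiff k i j <= n%:R].

Definition HHint : set (d.+1.-tuple int) :=
  [set k | HH k /\
    forall i j : 'I_d.+1, (i < j)%N -> - n%:R < kdiff k i j < n%:R].

Lemma finite_HHstar : finite_set HHstar.
Proof.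
pose N := (d.+1 * n)%N.
pose F (x : d.+1.-tuple 'I_(N + N).+1) : d.+1.-tuple int :=
  [tuple (tnth x i : nat)%:Z - N%:Z | i < d.+1].
apply: (@sub_finite_set _ _ (range F)); last exact/finite_image/finite_finset.
move=> k [[sk _] kb].
have kbN i j : tnth k i - tnth k j <= N%:Z.
  have : kdiff k i j <= n%:R.
    have [ij|ji|ij] := ltngtP i j.
    - by have /andP[] := kb _ _ ij.
    - have /andP[+ _] := kb _ _ ji.
      by rewrite lerNl /kdiff -mulNr -rmorphN /= opprB.
    - by rewrite (val_inj ij) /kdiff subrr mul0r.
  by rewrite /kdiff ler_pdivrMr// -natrM mulnC -(ler_int R).
have has0 : has xpredT (index_enum 'I_d.+1).
  by apply/hasP; exists ord0; rewrite ?mem_index_enum.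
have ub i : tnth k i <= N%:Z.
  rewrite leNgt; apply/negP => Ni.
  have : \sum_(j < d.+1) 0 < \sum_(j < d.+1) tnth k j.
    apply: Num.Theory.ltr_sum => // j _.
    by move: (kbN i j); rewrite lerBlDr => /(lt_le_trans Ni); rewrite ltrDl.
  by rewrite sk sumr_const mul0rn ltxx.
have lb i : - N%:Z <= tnth k i.
  rewrite leNgt; apply/negP => iN.
  have : \sum_(j < d.+1) tnth k j < \sum_(j < d.+1) 0.
    apply: Num.Theory.ltr_sum => // j _.
    by have := kbN j i; lia.
  by rewrite sk sumr_const mul0rn ltxx.
exists [tuple inord (absz (tnth k i + N%:Z)) | i < d.+1] => //.
apply: eq_from_tnth => i; rewrite !tnth_mktuple.
have := ub i; have := lb i => ? ?; rewrite inordK; lia.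
Qed.

Lemma finite_HHn : finite_set HHn.
Proof.
apply: sub_finite_set finite_HHstar => k [kH kb]; split=> // i j ij.
by have /andP[/ltW -> ->] := kb _ _ ij.
Qed.

Definition phi k t : R[i] :=
  let x := 2 * pi / d.+1%:R * \sum_(i < d.+1) (tnth k i)%:~R * tnth t i in
  cos x +i* sin x.

Definition node k : Rn R d.+1 :=
  [tuple (tnth k i)%:~R / (d.+1 * n)%:R | i < d.+1].

Definition BB (I J : {set 'I_d.+1}) : set (Rn R d.+1) :=
  [set t | RH R d t /\ forall i j, i \in I -> j \in J ->
    tnth t j = tnth t i - 1 /\
    forall l, l \notin I :|: J -> tnth t j < tnth t l < tnth t i].

Definition HHij (i j : nat) : set (d.+1.-tuple int) :=
  [set k | HH k /\ exists I J : {set 'I_d.+1},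
    [/\ [disjoint I & J]%bool, #|I| = i, #|J| = j & BB I J (node k)]].

Lemma BB_extrema (I J : {set 'I_d.+1}) t :
  (0 < #|I|)%N -> (0 < #|J|)%N -> [disjoint I & J]%bool -> BB I J t ->
  I = finset (fun l => [forall m, tnth t m <= tnth t l]) /\
  J = finset (fun l => [forall m, tnth t l <= tnth t m]).
Proof.
move=> /card_gt0P[i iI] /card_gt0P[j jJ] IJ [_ tIJ].
have [tji tl] := tIJ _ _ iI jJ.
have tI l : l \in I -> tnth t l = tnth t i.
  by move=> lI; have [] := tIJ _ _ lI jJ; rewrite tji => /addIr.
have tJ l : l \in J -> tnth t l = tnth t j.
  by move=> lJ; have [] := tIJ _ _ iI lJ; rewrite tji.
have ji : tnth t j < tnth t i by rewrite tji gtrBl.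
have between l : l \notin I -> l \notin J -> tnth t j < tnth t l < tnth t i.
  by move=> lI lJ; apply: tl; rewrite inE negb_or lI.
have le_max m : tnth t m <= tnth t i.
  have [/tI->//|mI] := boolP (m \in I).
  have [/tJ->|mJ] := boolP (m \in J); first exact: ltW.
  by have /andP[_ /ltW] := between _ mI mJ.
have ge_min m : tnth t j <= tnth t m.
  have [/tJ->//|mJ] := boolP (m \in J).
  have [/tI->|mI] := boolP (m \in I); first exact: ltW.
  by have /andP[/ltW] := between _ mI mJ.
split; apply/setP => l; rewrite [RHS]inE; apply/idP/forallP.
- by move=> /tI -> m.
- move=> /(_ i) il; apply: contraTT il => lI; rewrite -ltNge.
  have [/tJ->//|lJ] := boolP (l \in J).
  by have /andP[] := between _ lI lJ.
- by move=> /tJ -> m.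
- move=> /(_ j) lj; apply: contraTT lj => lJ; rewrite -ltNge.
  have [/tI->//|lI] := boolP (l \in I).
  by have /andP[] := between _ lI lJ.
Qed.

Lemma HHij_inj k (i j i' j' : nat) :
  (0 < i)%N -> (0 < j)%N -> (0 < i')%N -> (0 < j')%N ->
  HHij i j k -> HHij i' j' k -> i = i' /\ j = j'.
Proof.
move=> i0 j0 i'0 j'0 [_ [I [J [IJ Ii Jj BIJ]]]] [_ [I' [J' [IJ' Ii' Jj' BIJ']]]].
rewrite -Ii in i0 *; rewrite -Jj in j0 *.
rewrite -Ii' in i'0 *; rewrite -Jj' in j'0 *.
have [-> ->] := BB_extrema i0 j0 IJ BIJ.
by have [-> ->] := BB_extrema i'0 j'0 IJ' BIJ'.
Qed.

Lemma HHij_notint k (i j : nat) :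
  (0 < i)%N -> (0 < j)%N -> HHij i j k -> ~ HHint k.
Proof.
move=> i0 j0 [_ [I [J [IJ Ii Jj [_ BIJ]]]]] [_ kint].
move: i0 j0; rewrite -Ii -Jj => /card_gt0P[p pI] /card_gt0P[q qJ].
have [+ _] := BIJ _ _ pI qJ; rewrite !tnth_mktuple => /eqP.
have [n0|n0] := eqVneq n 0%N.
  by rewrite n0 muln0 invr0 !mulr0 sub0r eq_sym oppr_eq0 oner_eq0.
rewrite eq_sym subr_eq addrC -subr_eq -mulrBl -rmorphB /= natrM invfM mulrA.
rewrite -/(kdiff k p q) => /eqP kpq.
have {}kpq : kdiff k p q = n%:R.
  by rewrite -[LHS](divfK (_ : n%:R != 0)) ?pnatr_eq0// kpq mul1r.
have kqp : kdiff k q p = - n%:R.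
  by rewrite -kpq /kdiff -mulNr -rmorphN /= opprB.
have [pq|qp|pq] := ltngtP p q.
- by have := kint _ _ pq; rewrite kpq ltxx andbF.
- by have := kint _ _ qp; rewrite kqp ltxx.
- by move/disjointFr: IJ => /(_ _ pI); rewrite (val_inj pq) qJ.
Qed.

(* The pair (i, j) is unique when it exists: see [HHij_inj] and [weight_HHij]. *)
Definition weight k : R :=
  if `[< HHint k >] then 1
  else if [pick ij : 'I_d.+2 * 'I_d.+2 |
             [&& 0 < ij.1, 0 < ij.2, ij.1 + ij.2 <= d.+1 &
                 `[< HHij ij.1 ij.2 k >]]%N] is Some ij
  then ('C(ij.1 + ij.2, ij.1)%:R)^-1
  else 0.

Lemma weight_HHint k : HHint k -> weight k = 1.
Proof. by move=> kint; rewrite /weight asboolT. Qed.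

Lemma weight_HHij k (i j : nat) :
  (0 < i)%N -> (0 < j)%N -> (i + j <= d.+1)%N -> HHij i j k ->
  weight k = ('C(i + j, i)%:R)^-1.
Proof.
move=> i0 j0 ijd kij; rewrite /weight asboolF; last exact: (HHij_notint i0 j0).
case: pickP => [[i' j'] /= /and4P[i'0 j'0 _ /asboolP kij']|].
  by have [-> ->] := HHij_inj i0 j0 i'0 j'0 kij kij'.
have id : (i < d.+2)%N by rewrite ltnS (leq_trans _ ijd)// leq_addr.
have jd : (j < d.+2)%N by rewrite ltnS (leq_trans _ ijd)// leq_addl.
by move=> /(_ (Ordinal id, Ordinal jd)); rewrite /= i0 j0 ijd/= asboolT.
Qed.

(* Elements of the span, as functions on the hyperplane: nothing is imposed on *)
(* the values of f outside of it.                                              *)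
Definition HHspan : set (Rn R d.+1 -> R[i]) :=
  [set f | exists a : d.+1.-tuple int -> R[i],
    forall t, RH R d t -> f t = \sum_(k \in HHn) a k * phi k t].

Definition ip f g : R[i] :=
  ((Num.sqrt d.+1%:R)^-1)%:C *
  cintegral (surface R d) OmegaH (fun t => f t * (g t)^*).

Definition ipn f g : R[i] :=
  (d.+1 * n ^ d)%:R^-1 * \sum_(j \in HHn) f (node j) * (g (node j))^*.

Definition ipn_star f g : R[i] :=
  (d.+1 * n ^ d)%:R^-1 *
  \sum_(j \in HHstar) (weight j)%:C * f (node j) * (g (node j))^*.

End lattice.
Arguments HHspan : clear implicits.

(* Main.v *)
Require Import Defs.
From mathcomp Require Import finmap.
From mathcomp Require Import all_boot all_order all_algebra.
From mathcomp Require Import all_classical all_reals all_analysis measurable_realfun.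
From mathcomp Require Import zify ring lra.
From mathcomp.real_closed Require Import complex.

(** All three forms are averages of f * g^* over a system of representatives of
a torus, and the exponentials phi_k with k in H_n are orthonormal for the first
two of them.

Write A for the lattice of integer vectors of sum zero.  The half-open
polytope Omega_H meets each coset t + A of the hyperplane in exactly one point
([OmegaH_exists], [OmegaH_unique]).  Since phi_k is A-periodic for k in H
([phi_lattice]), its average over Omega_H is its average over the torus
RH / A; in the coordinates given by [RH_param] this is the torus R^d / Z^d, and
phi_k becomes a character of it, which is trivial only for k = 0.  A nontrivial
character takes the value -1 somewhere, and shifting the torus by such a point
changes the sign of the integral, which therefore vanishes
([periodic_Rintegral_eq0]).  This argument and the computation of the
volume of Omega_H rest on the fact that the integral of a periodic function over
a fundamental domain does not depend on the domain ([integral_fundamental]).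

The same tiling, read on the points k / ((d+1) n), says that H_n is a system of
representatives of H modulo (d+1) n A ([HHn_exists], [HHn_unique]).  On this
finite group the character j |-> phi_k (j / ((d+1) n)) is trivial only if k lies
in (d+1) n A; two distinct elements of H_n never differ by such a k, so the same
shift argument makes their discrete inner product vanish
([sum_HHn_phi_eq0]).  The norm of phi_k is 1 because the group has
(d+1) n^d elements ([size_HHn]).

Finally, the points of H_n^* congruent to a given k in H_n are obtained by
choosing anew, inside the set of the coordinates of k that are largest or
smallest in an extreme pair, which of them are largest ([perm_fibre]).  There
are binomial(i+j, i) choices, and this is the inverse of the weight that these
points have in common.  The weights of a class thus add up to 1
([sum_weight_fibre]), which turns a weighted sum over H_n^* of a periodic
function into its sum over H_n ([sum_star]). *)

Set Implicit Arguments.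
Unset Strict Implicit.
Unset Printing Implicit Defensive.

Import Order.TTheory GRing.Theory Num.Theory.
Import numFieldNormedType.Exports.

Local Open Scope classical_set_scope.
Local Open Scope complex_scope.
Local Open Scope ring_scope.

(** * The polytope as a tile of the hyperplane *)

Lemma exists_top_set (T : finType) (disp : Order.disp_t) (K : orderType disp)
    (key : T -> K) (p : nat) : (p <= #|T|)%N ->
  exists S : {set T}, #|S| = p /\
    forall i j, i \in S -> j \notin S -> (key j <= key i)%O.
Proof.
elim: p => [|p IHp] pT; first by exists finset.set0; rewrite cards0; split=> // i j;
  rewrite inE.
have [S [Sp SK]] := IHp (ltnW pT).
have /card_gt0P[x0 x0S] : (0 < #|~: S|)%N by rewrite cardsCs finset.setCK Sp subn_gt0.
rewrite inE in x0S.
case: (@arg_maxP _ _ _ x0 (fun x => x \notin S) key x0S) => x xS xmax.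
exists (x |: S)%SET; split=> [|i j]; first by rewrite cardsU1 xS Sp.
rewrite !inE => /orP[/eqP->|iS]; rewrite negb_or => /andP[_ jS]; last exact: SK.
exact: xmax.
Qed.

Section tile.
Variables (R : realType) (d : nat).
Implicit Types (t : Rn R d.+1).

(** Subtracting its integer part from each coordinate leaves fractional parts in
[0, 1) whose sum is an integer p < d+1, and 1 must then be subtracted from p of
them.  The differences stay in (-1, 1] when the p largest are chosen; the
half-open side of the interval decides between equal fractional parts, in
favour of the larger index, whence the lexicographic key. *)
Lemma OmegaH_exists t : RH R d t ->
  exists z : 'I_d.+1 -> int, \sum_i z i = 0 /\
    OmegaH [tuple tnth t i + (z i)%:~R | i < d.+1].
Proof.
move=> t0; pose f (i : 'I_d.+1) : R := tnth t i - (Num.floor (tnth t i))%:~R.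
have f01 i : 0 <= f i < 1.
  by rewrite subr_ge0 ge_floor ltrBlDl -[ltRHS]intrD1 lt_succ_floor.
(* the number of fractional parts to be lowered by 1 *)
pose P : int := - \sum_i Num.floor (tnth t i).
have fP : \sum_i f i = P%:~R.
  by rewrite sumrB (t0 : _ = 0) sub0r /P rmorphN /= rmorph_sum.
have P0 : 0 <= P by rewrite -(ler_int R) -fP sumr_ge0// => i _; have /andP[] := f01 i.
have PN : P < d.+1%:Z.
  rewrite -(ltr_int R) -fP.
  have -> : d.+1%:~R = \sum_(i < d.+1) 1 :> R by rewrite sumr_const card_ord.
  apply: ltr_sum => [|i _]; last by have /andP[] := f01 i.
  by apply/hasP; exists ord0; rewrite ?mem_index_enum.
pose key (i : 'I_d.+1) : (R *l nat)%type := (f i, i : nat).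
have [|S [Sp SK]] := @exists_top_set _ _ _ key (absz P); first by rewrite card_ord; lia.
exists (fun i => - Num.floor (tnth t i) - (i \in S)%:R); split.
  rewrite sumrB sumrN -/P -natr_sum -[X in X%:R]big_mkcond /= sum1_card Sp.
  by rewrite natz gez0_abs// subrr.
have eE i : tnth t i + (- Num.floor (tnth t i) - (i \in S)%:R)%:~R = f i - (i \in S)%:R.
  by rewrite rmorphB rmorphN /= addrA; congr (_ - _); case: (i \in S).
split=> [|i j ij].
  rewrite /RH /=; under eq_bigr do rewrite tnth_mktuple eE.
  rewrite sumrB fP -natr_sum -[X in _ - X%:R]big_mkcond /= sum1_card Sp.
  by rewrite -[P in P%:~R](gez0_abs P0) subrr.
rewrite !tnth_mktuple !eE; have := f01 i; have := f01 j.
have [iS|iS] := boolP (i \in S); have [jS|jS] := boolP (j \in S) => /= /andP[? ?] /andP[? ?].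
- lra.
- have := SK _ _ iS jS; rewrite /key [(_ <= _)%O]/Order.le /=.
  move=> /andP[ji /implyP h].
  suff : f j < f i by lra.
  rewrite lt_neqAle ji andbT; apply/eqP => fij; move: h; rewrite fij lexx => /(_ isT).
  by rewrite leEnat leqNgt ij.
- have := SK _ _ jS iS; rewrite /key [(_ <= _)%O]/Order.le /=.
  move=> /andP[+ _]; rewrite -[_ <= _]/(f i <= f j) => ij'.
  by apply/andP; split; lra.
- lra.
Qed.

Lemma int_sum0_signs (z : 'I_d.+1 -> int) : \sum_i z i = 0 ->
  (forall i, z i = 0) \/ exists a b, 0 < z a /\ z b < 0.
Proof.
move=> z0.
have neg (u : 'I_d.+1 -> int) l : \sum_i u i = 0 -> 0 < u l -> exists j, u j < 0.
  move=> u0 ul; apply: contrapT => /forallNP h.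
  suff : 0 < \sum_i u i by rewrite u0 ltxx.
  rewrite (bigD1 l)//= ltr_wpDr// sumr_ge0// => i _.
  by rewrite leNgt; apply/negP/h.
have [|/existsNP[i zi]] := pselect (forall i, z i = 0); [by left|right].
have [{}zi|{}zi|//] := ltgtP (z i) 0; last first.
  by have [j zj] := neg z i z0 zi; exists i, j.
have [||j] := neg (fun i => - z i) i; rewrite ?sumrN ?z0 ?oppr0 ?oppr_gt0//.
by rewrite oppr_lt0 => zj; exists j, i.
Qed.

(** Two differences of coordinates in (-1, 1] differ by less than 2, whereas a
nonzero integer vector of sum zero has a positive and a negative coordinate,
which differ by at least 2. *)
Lemma OmegaH_unique t t' (z : 'I_d.+1 -> int) : OmegaH t -> OmegaH t' ->
  (forall i, tnth t' i = tnth t i + (z i)%:~R) -> forall i, z i = 0.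
Proof.
move=> [t0 tO] [t'0 t'O] tt'.
have [||[i [j [zi zj]]]] := @int_sum0_signs z; [|by []|].
  apply: (@intr_inj R); rewrite rmorph_sum /=.
  have := t'0; rewrite /RH /=; under eq_bigr do rewrite tt'.
  by rewrite big_split /= (t0 : _ = 0) add0r.
suff : z i - z j < 2 by lia.
rewrite -(ltr_int R) rmorphB /=.
have zE l : (z l)%:~R = tnth t' l - tnth t l by rewrite tt' addrC addKr.
rewrite !zE; have [ij|ji|/val_inj->] := ltngtP i j; last lra.
- by have := tO _ _ ij; have := t'O _ _ ij => /andP[? ?] /andP[? ?]; lra.
- by have := tO _ _ ji; have := t'O _ _ ji => /andP[? ?] /andP[? ?]; lra.
Qed.

End tile.

(** * Translation invariance of the measure on tuples *)

Definition tshift (R : realType) n (v s : Rn R n) : Rn R n :=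
  [tuple tnth s i + tnth v i | i < n].

Definition ivec (R : realType) n (z : n.-tuple int) : Rn R n :=
  [tuple (tnth z i)%:~R | i < n].

Definition inegt n (z : n.-tuple int) : n.-tuple int := [tuple - tnth z i | i < n].

Section shift.
Variable R : realType.

Lemma measurable_tshift n (v : Rn R n) : measurable_fun [set: _] (tshift v).
Proof.
apply/measurable_fun_tnthP => i.
rewrite (_ : _ \o _ = fun s => tnth s i + tnth v i); last first.
  by apply/funext => s /=; rewrite tnth_mktuple.
by apply: measurable_funD => //; exact: measurable_tnth.
Qed.

Lemma measurable_preimage_tshift n (v : Rn R n) A :
  measurable A -> measurable (tshift v @^-1` A).
Proof. by move=> mA; rewrite -[X in measurable X]setTI; exact: measurable_tshift. Qed.

Lemma lebesgue_measure_shift (x : R) (A : set (measurableTypeR R)) : measurable A ->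
  lebesgue_measure ((fun y : measurableTypeR R => y + x) @^-1` A) = lebesgue_measure A.
Proof.
have mx : measurable_fun [set: measurableTypeR R] (fun y : measurableTypeR R => y + x).
  by apply: measurable_funD.
move=> mA; pose nu : {measure set (measurableTypeR R) -> \bar R} :=
  @measure_function_pushforward__canonical__measure_function_Measure _ _
    (measurableTypeR R) (measurableTypeR R) R lebesgue_measure _ mx.
apply/esym; rewrite -[RHS]/(nu A); apply: lebesgue_measure_unique => // X [[a b] _ <-].
rewrite -[RHS]/(lebesgue_measure ((fun y : measurableTypeR R => y + x) @^-1` _)).
have -> : (fun y : measurableTypeR R => y + x) @^-1` `]a, b] = `]a - x, b - x]%classic.
  by apply/seteqP; split=> y /=; rewrite !in_itv /= ltrBlDr lerBrDr.
rewrite !lebesgue_measure_itv /= !lte_fin ltrD2r.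
by case: ifP => // _; rewrite -!EFinB; congr (_%:E)%E; ring.
Qed.

Lemma tuple0_eq n (s t : Rn R n) : n = 0%N -> s = t.
Proof. by move=> n0; apply: eq_from_tnth => -[j jn]; exfalso; move: jn; rewrite n0. Qed.

(** By induction on the dimension: the image of the product measure under the
shift agrees with it on rectangles, and this determines it. *)
Lemma lebesgue_tuple_shift n (v : Rn R n) (A : set (Rn R n)) : measurable A ->
  lebesgue_tuple R n (tshift v @^-1` A) = lebesgue_tuple R n A.
Proof.
elim: n v A => [|n IHn] v A mA.
  by congr (lebesgue_tuple R 0 _); apply/seteqP; split=> s;
    rewrite /preimage /= (@tuple0_eq 0 (tshift v s) s).
pose T (p : measurableTypeR R * Rn R n) : measurableTypeR R * Rn R n :=
  (p.1 + thead v, tshift [tuple of behead v] p.2).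
have mT : measurable_fun [set: _] T.
  apply/measurable_fun_pair => /=; first by apply: measurable_funD.
  by apply: measurableT_comp => //; exact: measurable_tshift.
pose m := (@lebesgue_measure R \x lebesgue_tuple R n)%E.
pose nu : {measure set (measurableTypeR R * Rn R n) -> \bar R} :=
  measure_function_pushforward__canonical__measure_function_Measure m mT.
have mc : measurable (@cons_pair R n @^-1` A).
  by rewrite -[X in measurable X]setTI; exact: measurable_cons_pair.
rewrite -[LHS]/(m (@cons_pair R n @^-1` _)) -[RHS]/(m (@cons_pair R n @^-1` _)).
have consT p : tshift v (cons_pair p) = cons_pair (T p).
  apply: eq_from_tnth => i; rewrite tnth_mktuple /cons_pair /=.
  have [j ->|->] := unliftP ord0 i; last by rewrite !tnth0.
  by rewrite !tnthS tnth_mktuple; congr (_ + _); rewrite {1}(tuple_eta v) tnthS.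
have -> : @cons_pair R n @^-1` (tshift v @^-1` A) = T @^-1` (@cons_pair R n @^-1` A).
  by apply/funext => p; rewrite /preimage /mkset consT.
rewrite -[LHS]/(nu (@cons_pair R n @^-1` A)); apply/esym.
apply: product_measure_unique => // B C mB mC.
rewrite -[LHS]/(m (T @^-1` _)) (_ : T @^-1` _ = ((fun y => y + thead v) @^-1` B) `*`
    (tshift [tuple of behead v] @^-1` C)); last first.
  by apply/seteqP; split=> -[x s].
have mB' : measurable ((fun y : measurableTypeR R => y + thead v) @^-1` B).
  rewrite -[X in measurable X]setTI.
  by apply: (_ : measurable_fun setT _) => //; apply: measurable_funD.
rewrite /m product_measure1E//; last exact: measurable_preimage_tshift.
congr (_ * _)%E; first exact: lebesgue_measure_shift.
exact: IHn.
Qed.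

End shift.

(** * Fundamental domains of the integer lattice *)

(** The translates of [D] form an exact partition, so that cutting a set along them
is an equality of sets and not only up to a null set. *)
Definition fundamental (R : realType) n (D : set (Rn R n)) :=
  forall s, exists! z : n.-tuple int, D (tshift (ivec R z) s).

Section fundamental.
Variables (R : realType) (n : nat).
Let mu := lebesgue_tuple R n.
Implicit Types (D E : set (Rn R n)) (h : Rn R n -> \bar R) (v s : Rn R n).

Lemma tshiftC v w s : tshift v (tshift w s) = tshift w (tshift v s).
Proof. by apply: eq_from_tnth => i; rewrite !tnth_mktuple addrAC. Qed.

Lemma tshift_inegtK (z : n.-tuple int) :
  cancel (tshift (ivec R (inegt z))) (tshift (ivec R z)).
Proof.
by move=> s; apply: eq_from_tnth => i; rewrite !tnth_mktuple rmorphN /= subrK.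
Qed.

Lemma inegtK : involutive (@inegt n).
Proof. by move=> z; apply: eq_from_tnth => i; rewrite !tnth_mktuple opprK. Qed.

Lemma ge0_integral_tshift v D h : measurable D -> measurable_fun setT h ->
  (forall s, (0 <= h s)%E) ->
  (\int[mu]_(s in tshift v @^-1` D) h (tshift v s) = \int[mu]_(s in D) h s)%E.
Proof.
move=> mD mh h0.
rewrite -(ge0_integral_pushforward (measurable_tshift v))//; last exact: measurable_funTS.
pose nu : {measure set (Rn R n) -> \bar R} :=
  measure_function_pushforward__canonical__measure_function_Measure mu (measurable_tshift v).
rewrite -[LHS]/(\int[nu]_(s in D) h s)%E; apply: eq_measure_integral => A mA _.
exact: lebesgue_tuple_shift.
Qed.

Lemma integral_tshift v D h : measurable D -> measurable_fun setT h ->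
  (\int[mu]_(s in tshift v @^-1` D) h (tshift v s) = \int[mu]_(s in D) h s)%E.
Proof.
move=> mD mh; rewrite [LHS]integralE [RHS]integralE.
rewrite -(ge0_integral_tshift v mD (measurable_funepos mh))//.
rewrite -(ge0_integral_tshift v mD (measurable_funeneg mh))//.
by congr (_ - _)%E; apply: eq_integral => s _; rewrite ?funeposE ?funenegE.
Qed.

(** The sum runs over the codes of the integer vectors, because countable
additivity concerns families indexed by the natural numbers. *)
Lemma ge0_integral_partition (G : n.-tuple int -> set (Rn R n)) D h :
  (forall z, measurable (G z)) -> (forall s, exists! z, G z s) ->
  measurable D -> measurable_fun setT h -> (forall s, (0 <= h s)%E) ->
  (\int[mu]_(s in D) h s = \sum_(k <oo)
    if @pickle_inv (n.-tuple int) k is Some z then \int[mu]_(s in D `&` G z) h s else 0)%E.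
Proof.
move=> mG G1 mD mh h0.
pose F k := if @pickle_inv (n.-tuple int) k is Some z then D `&` G z else set0.
have DF : D = \bigcup_k F k.
  apply/seteqP; split=> [s Ds|s [k _]]; last by rewrite /F; case: pickle_inv => // z [].
  have [z [Gz _]] := G1 s; exists (pickle z) => //.
  by rewrite /F pickleK_inv.
rewrite [in LHS]DF ge0_integral_bigcup//.
- apply: eq_eseriesr => k _; rewrite /F; case: pickle_inv => //.
  by rewrite integral_set0.
- by move=> k; rewrite /F; case: pickle_inv => // z; exact: measurableI.
- by rewrite -DF; exact: measurable_funTS.
- apply/trivIsetP => i j _ _; rewrite /F.
  case Ei : pickle_inv => [z|]; last by rewrite set0I.
  case Ej : pickle_inv => [w|]; last by rewrite setI0.
  move=> ij; rewrite -subset0 => s [[_ Gz] [_ Gw]].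
  have [u [_ uu]] := G1 s; have zw : z = w by rewrite -(uu _ Gz) -(uu _ Gw).
  have := @pickle_invK (n.-tuple int) i; have := @pickle_invK (n.-tuple int) j.
  by rewrite Ei Ej /= zw => jw iw; rewrite -iw jw eqxx in ij.
Qed.

(** [D] is cut along the translates of [E], and each piece is brought back into
[E] by a lattice vector; the pieces then cut [E] along the translates of [D]. *)
Lemma ge0_integral_fundamental D E h :
  measurable D -> measurable E -> fundamental D -> fundamental E ->
  measurable_fun setT h -> (forall s, (0 <= h s)%E) ->
  (forall z s, h (tshift (ivec R z) s) = h s) ->
  (\int[mu]_(s in D) h s = \int[mu]_(s in E) h s)%E.
Proof.
move=> mD mE fD fE mh h0 hper.
rewrite (ge0_integral_partition (G := fun z => tshift (ivec R z) @^-1` E))//; last first.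
  by move=> z; exact: measurable_preimage_tshift.
rewrite [RHS](ge0_integral_partition
  (G := fun z => tshift (ivec R (inegt z)) @^-1` D))//; last 2 first.
  by move=> z; exact: measurable_preimage_tshift.
  move=> s; have [z [Dz uz]] := fD s; exists (inegt z); split=> [|w Dw].
    by rewrite /= inegtK.
  by rewrite (uz _ Dw) inegtK.
apply: eq_eseriesr => k _; case: pickle_inv => // z.
rewrite -(ge0_integral_tshift (ivec R (inegt z)))//; last first.
  by apply: measurableI => //; exact: measurable_preimage_tshift.
under eq_integral do rewrite hper.
congr integral; rewrite preimage_setI setIC -comp_preimage; congr (_ `&` _).
rewrite (_ : _ \o _ = id) ?preimage_id//.
by apply/funext => s /=; exact: tshift_inegtK.
Qed.

(** The positive and negative parts of [h] are periodic as well, and their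
integrals agree separately. *)
Lemma integral_fundamental D E h :
  measurable D -> measurable E -> fundamental D -> fundamental E ->
  measurable_fun setT h ->
  (forall z s, h (tshift (ivec R z) s) = h s) ->
  (\int[mu]_(s in D) h s = \int[mu]_(s in E) h s)%E.
Proof.
move=> mD mE fD fE mh hper; rewrite [LHS]integralE [RHS]integralE.
congr (_ - _)%E; apply: ge0_integral_fundamental => //.
- exact: measurable_funepos.
- by move=> z s; rewrite !funeposE hper.
- exact: measurable_funeneg.
- by move=> z s; rewrite !funenegE hper.
Qed.

Lemma fundamental_tshift D v : fundamental D -> fundamental (tshift v @^-1` D).
Proof.
move=> fD s; have [z [Dz uz]] := fD (tshift v s); exists z; split=> [|w].
  by rewrite /= tshiftC.
by rewrite /= tshiftC; exact: uz.
Qed.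

Definition cube : set (Rn R n) := [set s | forall i, 0 <= tnth s i < 1].

Lemma fundamental_cube : fundamental cube.
Proof.
move=> s; exists [tuple - Num.floor (tnth s i) | i < n]; split=> [i|z zQ].
  rewrite !tnth_mktuple rmorphN /= subr_ge0 ge_floor ltrBlDl -[ltRHS]intrD1.
  by rewrite lt_succ_floor.
apply: eq_from_tnth => i; rewrite tnth_mktuple.
have := zQ i; rewrite !tnth_mktuple => /andP[z0 z1].
rewrite (@floor_def _ _ (- tnth z i)) ?opprK// rmorphD rmorphN /=.
by apply/andP; split; lra.
Qed.

Lemma cubeE : cube =
  \bigcap_(i in [set: 'I_n]) ((@tnth n (measurableTypeR R))^~ i @^-1` `[0, 1[).
Proof.
apply/seteqP; split=> s sQ i; first by move=> _ /=; rewrite in_itv /=; exact: sQ.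
by have := sQ i Logic.I; rewrite /= in_itv /=.
Qed.

Lemma measurable_cube : measurable cube.
Proof.
rewrite cubeE; apply: fin_bigcap_measurable => // i _.
by rewrite -[X in measurable X]setTI; exact: measurable_tnth.
Qed.

End fundamental.
Arguments cube : clear implicits.

Lemma lebesgue_tuple_cube (R : realType) n : lebesgue_tuple R n (cube R n) = 1%E.
Proof.
elim: n => [|n IHn].
  rewrite /= diracE mem_set//; by case.
rewrite -[LHS]/((@lebesgue_measure R \x lebesgue_tuple R n)%E (@cons_pair R n @^-1` _)).
rewrite (_ : _ @^-1` _ = `[0, 1[ `*` cube R n); last first.
  apply/seteqP; split=> [[x s] xs|[x s] [/= x01 s01] i].
    split=> /=; first by have := xs ord0; rewrite /cons_pair /= tnth0 in_itv.
    by move=> i; have := xs (lift ord0 i); rewrite /cons_pair /= tnthS.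
  rewrite /cons_pair /=; have [j ->|->] := unliftP ord0 i; first by rewrite tnthS.
  by move: x01; rewrite tnth0 in_itv.
rewrite product_measure1E//; last exact: measurable_cube.
rewrite [X in (_ * X)%E]IHn mule1.
have := lebesgue_measure_itv (`[0 : R, 1[); rewrite /= lte_fin ltr01 -EFinB subr0.
exact.
Qed.

(** * Vanishing of the integrals of nontrivial characters *)

Lemma periodicz (R : realType) (V : zmodType) (h : R -> V) (a : R) :
  periodic h a -> forall (z : int) x, h (x + a * z%:~R) = h x.
Proof.
move=> ha [] k x; first by rewrite -pmulrn mulr_natr; exact: periodicn.
by rewrite NegzE mulrNz mulrN -[LHS](periodicn ha k.+1) -mulr_natr -pmulrn subrK.
Qed.

(** A shift by v = e_i0 / (2 m_i0) adds pi to the phase, so it changes the sign of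
the integrand; but it does not change the integral, because the shifted domain
is again fundamental. *)
Lemma periodic_Rintegral_eq0 (R : realType) n (D : set (Rn R n)) (h : R -> R)
    (m : 'I_n -> int) (i0 : 'I_n) :
  measurable D -> fundamental D -> lebesgue_tuple R n D = 1%E ->
  measurable_fun setT h -> alternating h pi -> (forall x, `|h x| <= 1) ->
  m i0 != 0 ->
  Rintegral (lebesgue_tuple R n) D
    (fun s => h (2 * pi * \sum_(i < n) (m i)%:~R * tnth s i)) = 0.
Proof.
move=> mD fD D1 mh ha h1 mi0.
set F := fun s : Rn R n => _.
have mF : measurable_fun setT F.
  apply: measurableT_comp => //; apply: measurable_funM => //.
  by apply: measurable_sum => i; apply: measurable_funM => //; exact: measurable_tnth.
have iF : (lebesgue_tuple R n).-integrable D (EFin \o F).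
  apply: measurable_bounded_integrable => //.
  - by have := ltry (1 : R); rewrite -D1.
  - exact: measurable_funTS.
  - exists 1; split; first exact: num_real.
    by move=> x x1 s _; exact: le_trans (h1 _) (ltW x1).
have hp : periodic h (pi *+ 2) by move=> x; rewrite mulr2n addrA !ha opprK.
have Fper z s : F (tshift (ivec R z) s) = F s.
  rewrite /F.
  rewrite -[RHS](periodicz hp (\sum_i m i * tnth z i)); congr h.
  rewrite rmorph_sum /=.
  under eq_bigr do rewrite !tnth_mktuple mulrDr.
  rewrite big_split /= mulrDr; congr (_ + _); rewrite -[pi *+ 2]mulr_natl.
  by congr (_ * _); apply: eq_bigr => i _; rewrite rmorphM.
(* a shift along which the phase grows by pi *)
pose v : Rn R n := [tuple (i == i0)%:R / (2 * (m i0)%:~R) | i < n].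
have Fv s : F (tshift v s) = - F s.
  rewrite /F -ha; congr h.
  under eq_bigr do rewrite !tnth_mktuple mulrDr.
  rewrite big_split /= mulrDr; congr (_ + _).
  rewrite (bigD1 i0)//= big1 => [|i ii0]; last by rewrite (negbTE ii0) mul0r mulr0.
  have : (m i0)%:~R != 0 :> R by rewrite intr_eq0.
  by rewrite eqxx addr0 /= mul1r => ?; field.
suff : Rintegral (lebesgue_tuple R n) D F = - Rintegral (lebesgue_tuple R n) D F.
  by move=> /eqP; rewrite -addr_eq0 -mulr2n mulrn_eq0 => /eqP.
have -> : - Rintegral (lebesgue_tuple R n) D F =
    Rintegral (lebesgue_tuple R n) D (fun s => F (tshift v s)).
  rewrite -mulN1r -RintegralZl//.
  by apply: eq_Rintegral => s _; rewrite Fv mulN1r.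
rewrite /Rintegral; congr fine.
rewrite -(integral_tshift v mD (h := EFin \o F)); last exact/measurable_EFinP.
apply: (@integral_fundamental _ _ (tshift v @^-1` D) D (fun s => (F (tshift v s))%:E)) => //.
- exact: measurable_preimage_tshift.
- exact: fundamental_tshift.
- by apply/measurable_EFinP; apply: measurableT_comp => //; exact: measurable_tshift.
- by move=> z s; rewrite tshiftC Fper.
Qed.

(** * The polytope in the coordinates of the hyperplane *)

Section hyperplane.
Variables (R : realType) (d : nat).

Let wd := widen_ord (leqnSn d).

Lemma ord_recrP (j : 'I_d.+1) : j = ord_max \/ exists i, j = wd i.
Proof.
have [jd|dj] := ltnP j d; [right|left].
  by exists (Ordinal jd); exact: val_inj.
by apply/val_inj/eqP; rewrite eqn_leq dj andbT -ltnS ltn_ord.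
Qed.

Lemma RH_RH_param (s : Rn R d) : RH R d (RH_param s).
Proof. by rewrite -range_RH_param; exists s. Qed.

Lemma RH_param_tshift (v s : Rn R d) :
  RH_param (tshift v s) = tshift (RH_param v) (RH_param s).
Proof.
apply: eq_from_tnth => j; rewrite !tnth_mktuple -big_split /=.
by apply: eq_bigr => i _; rewrite tnth_mktuple mulrDl.
Qed.

(** The Gram matrix of the rows e_i - e_(d+1) is the identity plus the all-ones
matrix.  Its determinant follows by factoring a bordered matrix in two ways, with
the Schur complement on either side. *)
Lemma RH_gramE : RH_gram R d = Num.sqrt d.+1%:R.
Proof.
rewrite /RH_gram; congr Num.sqrt.
pose u : 'cV[R]_d := const_mx 1; pose v : 'rV[R]_d := const_mx 1.
have -> : RH_basis R d *m (RH_basis R d)^T = 1%:M + u *m v.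
  apply/matrixP => i j; rewrite !mxE big_ord_recr big_ord1 /= !mxE.
  have eq_max l : (ord_max == wd l) = false.
    by rewrite -val_eqE /= gtn_eqF.
  have eq_wd k l : (wd k == wd l) = (k == l) by rewrite -!val_eqE.
  have eq_wdmax l : (wd l == ord_max) = false by rewrite eq_sym.
  rewrite (bigD1 i)//= big1 => [|k ki]; rewrite !mxE ?eqxx ?eq_max ?eq_wd ?eq_wdmax.
    by rewrite !subr0 addr0 !sub0r mulrNN !mul1r.
  by rewrite (negbTE ki) subr0 mul0r.
(* det (1 + u v) = det (1 + v u), and v u is the 1 x 1 matrix d *)
transitivity (\det (block_mx 1%:M (- v) u 1%:M)).
  have -> : block_mx 1%:M (- v) u 1%:M =
      block_mx 1%:M 0 u 1%:M *m block_mx 1%:M (- v) 0 (1%:M + u *m v).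
    rewrite mulmx_block ?(mul1mx, mul0mx, mulmx1, mulmx0, addr0, add0r) mulmxN.
  by rewrite addrCA addNr addr0.
  by rewrite det_mulmx det_lblock det_ublock !det1 !mul1r.
have -> : block_mx 1%:M (- v) u 1%:M =
    block_mx (1%:M + v *m u) (- v) 0 1%:M *m block_mx 1%:M 0 u 1%:M.
  rewrite mulmx_block !(mul1mx, mul0mx, mulmx1, mulmx0, addr0, add0r) mulNmx.
  by rewrite addrK.
rewrite det_mulmx det_lblock det_ublock !det1 !mulr1 det_mx11 !mxE eqxx.
under eq_bigr do rewrite !mxE mulr1.
by rewrite sumr_const card_ord -mulrS.
Qed.

Lemma measurable_RH : measurable (RH R d).
Proof.
rewrite (_ : RH R d = (fun t : Rn R d.+1 => \sum_i tnth t i) @^-1` [set 0])//.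
rewrite -[X in measurable X]setTI.
apply: (_ : measurable_fun setT _) => //.
by apply: measurable_sum => i; exact: measurable_tnth.
Qed.

Lemma measurable_OmegaH : measurable (@OmegaH R d).
Proof.
rewrite (_ : @OmegaH R d = RH R d `&`
  \bigcap_(p in [set p : 'I_d.+1 * 'I_d.+1 | (p.1 < p.2)%N])
    ((fun t : Rn R d.+1 => tnth t p.1 - tnth t p.2) @^-1` `]-1, 1])); last first.
  apply/seteqP; split=> t [t0 tO]; split=> //.
    by move=> [i j] ij /=; rewrite in_itv; exact: tO.
  by move=> i j ij; have := tO (i, j) ij; rewrite /= in_itv.
apply: measurableI; first exact: measurable_RH.
apply: fin_bigcap_measurable => [|[i j] _ /=]; first exact: finite_finset.
rewrite -[X in measurable X]setTI.
apply: (_ : measurable_fun setT _) => //.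
by apply: measurable_funB => //; exact: measurable_tnth.
Qed.

Let D : set (Rn R d) := @RH_param R d @^-1` @OmegaH R d.

Lemma measurable_OmegaH_param : measurable D.
Proof.
rewrite -[X in measurable X]setTI; apply: measurable_RH_param => //.
exact: measurable_OmegaH.
Qed.

Lemma RH_eqP (t t' : Rn R d.+1) : RH R d t -> RH R d t' ->
  (forall i, tnth t (wd i) = tnth t' (wd i)) -> t = t'.
Proof.
rewrite /RH /= !big_ord_recr /= => + + tt'.
rewrite (eq_bigr (fun i => tnth t' (wd i)))// => t0 t'0.
apply: eq_from_tnth => j; have [->|[i ->]] := ord_recrP j; last exact: tt'.
by apply: (@addrI _ (\sum_(i < d) tnth t' (wd i))); rewrite t0 t'0.
Qed.

(** [RH_param] maps the integer vectors onto the integer vectors of sum zero, so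
the tiling of the hyperplane by [OmegaH] is a tiling of its coordinate space. *)
Lemma fundamental_OmegaH_param : fundamental D.
Proof.
move=> s; have [sE sm] := RH_paramE s.
have [z [z0 zO]] := OmegaH_exists (RH_RH_param s).
exists [tuple z (wd i) | i < d]; split=> [|w Dw].
  rewrite /D /=.
  rewrite (_ : RH_param _ = [tuple tnth (RH_param s) i + (z i)%:~R | i < d.+1])//.
  apply: RH_eqP; [exact: RH_RH_param|by case: zO|] => i.
  by rewrite (RH_paramE _).1 !tnth_mktuple -sE tnth_mktuple.
apply: eq_from_tnth => i; rewrite tnth_mktuple.
pose w' := RH_param (ivec R w).
have w'E j : exists c : int, tnth w' j = c%:~R.
  have [->|[l ->]] := ord_recrP j; last first.
    by exists (tnth w l); rewrite /w' (RH_paramE _).1 tnth_mktuple.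
  exists (- \sum_l tnth w l); rewrite /w' (RH_paramE _).2 rmorphN rmorph_sum /=.
  by congr (- _); apply: eq_bigr => l _; rewrite tnth_mktuple.
have [c cE] := choice w'E.
have cz j : c j - z j = 0.
  apply: (OmegaH_unique zO Dw (z := fun j => c j - z j)) => l.
  by rewrite RH_param_tshift [LHS]tnth_mktuple [X in _ = X + _]tnth_mktuple -/w' cE rmorphB /=; ring.
apply/(@intr_inj R).
have <- : tnth (ivec R w) i = (tnth w i)%:~R by rewrite tnth_mktuple.
by rewrite -(RH_paramE (ivec R w)).1 -/w' cE; have /eqP := cz (wd i); rewrite subr_eq0 => /eqP <-.
Qed.

(** The domain has the volume of the unit cube, which is fundamental too. *)
Lemma lebesgue_OmegaH_param : lebesgue_tuple R d D = 1%E.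
Proof.
rewrite -(lebesgue_tuple_cube R d) -[LHS]mul1e -[RHS]mul1e -!integral_cst/=.
- apply: ge0_integral_fundamental => //; try exact: measurable_cube.
  + exact: measurable_OmegaH_param.
  + exact: fundamental_OmegaH_param.
  + exact: fundamental_cube.
- exact: measurable_cube.
- exact: measurable_OmegaH_param.
Qed.

End hyperplane.

(** * Integrals against the surface measure *)

Section surface.
Variables (R : realType) (d : nat).
Let D : set (Rn R d) := @RH_param R d @^-1` @OmegaH R d.

(** The factor is the volume of the parallelotope spanned by the basis of the
hyperplane that [RH_param] uses. *)
Lemma ge0_integral_surface (h : Rn R d.+1 -> \bar R) :
  measurable_fun setT h -> (forall t, (0 <= h t)%E) ->
  (\int[surface R d]_(t in @OmegaH R d) h t =
   (Num.sqrt d.+1%:R)%:E * \int[lebesgue_tuple R d]_(s in D) h (RH_param s))%E.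
Proof.
move=> mh h0; rewrite /surface ge0_integral_mscale//; last 2 first.
- exact: measurable_OmegaH.
- exact: measurable_funTS.
rewrite /= RH_gramE; congr (_ * _)%E.
rewrite ge0_integral_pushforward//.
- exact: measurable_RH_param.
- exact: measurable_OmegaH.
- exact: measurable_funTS.
Qed.

Lemma surface_OmegaH : surface R d (@OmegaH R d) = (Num.sqrt d.+1%:R)%:E.
Proof.
rewrite -[LHS]mul1e -integral_cst; last exact: measurable_OmegaH.
rewrite ge0_integral_surface// integral_cst; last exact: measurable_OmegaH_param.
by rewrite mul1e [X in (_ * X)%E]lebesgue_OmegaH_param mule1.
Qed.

Lemma Rintegral_surface (u : Rn R d.+1 -> R) :
  measurable_fun setT u -> (forall t, `|u t| <= 1) ->
  Rintegral (surface R d) (@OmegaH R d) u =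
  Num.sqrt d.+1%:R * Rintegral (lebesgue_tuple R d) D (u \o @RH_param R d).
Proof.
move=> mu u1; have mD : measurable D by exact: measurable_OmegaH_param.
have mup : measurable_fun setT (u \o @RH_param R d).
  by apply: measurableT_comp => //; exact: measurable_RH_param.
have iu : (lebesgue_tuple R d).-integrable D (EFin \o (u \o @RH_param R d)).
  apply: measurable_bounded_integrable => //.
  - by have := ltry (1 : R); rewrite -(lebesgue_OmegaH_param R d).
  - exact: measurable_funTS.
  - exists 1; split; first exact: num_real.
    by move=> x x1 s _; exact: le_trans (u1 _) (ltW x1).
have mu' : measurable_fun setT (EFin \o u) by exact/measurable_EFinP.
rewrite /Rintegral integralE !ge0_integral_surface//; last 2 first.
- exact: measurable_funeneg.
- exact: measurable_funepos.
have fp := integrable_fin_num mD (integrable_funepos mD iu).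
have fn := integrable_fin_num mD (integrable_funeneg mD iu).
have posE : (EFin \o (u \o @RH_param R d))^\+%E = fun s => ((EFin \o u)^\+ (RH_param s))%E.
  by apply/funext => s; rewrite !funeposE.
have negE : (EFin \o (u \o @RH_param R d))^\-%E = fun s => ((EFin \o u)^\- (RH_param s))%E.
  by apply/funext => s; rewrite !funenegE.
rewrite posE in fp; rewrite negE in fn.
rewrite -muleBr//; last exact: fin_num_adde_defr.
rewrite fineM//; last by rewrite fin_numB; apply/andP; split.
by rewrite [in RHS]integralE posE negE.
Qed.

Lemma integrable_surface (u : Rn R d.+1 -> R) :
  measurable_fun setT u -> (forall t, `|u t| <= 1) ->
  (surface R d).-integrable (@OmegaH R d) (EFin \o u).
Proof.
move=> mu u1; apply: measurable_bounded_integrable => //.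
- exact: measurable_OmegaH.
- by have := ltry (Num.sqrt d.+1%:R : R); rewrite -surface_OmegaH.
- exact: measurable_funTS.
- exists 1; split; first exact: num_real.
  by move=> x x1 s _; exact: le_trans (u1 _) (ltW x1).
Qed.

End surface.

(** * Integrals of the exponentials over the polytope *)

Section phase.
Variables (R : realType) (d : nat).
Let wd := widen_ord (leqnSn d).
Implicit Types (k : d.+1.-tuple int).

Definition phase k (t : Rn R d.+1) : R :=
  2 * pi / d.+1%:R * \sum_(i < d.+1) (tnth k i)%:~R * tnth t i.

Lemma phiE k t : phi k t = cos (phase k t) +i* sin (phase k t).
Proof. by []. Qed.

Lemma measurable_phase k : measurable_fun setT (phase k).
Proof.
apply: measurable_funM => //.
by apply: measurable_sum => i; apply: measurable_funM => //; exact: measurable_tnth.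
Qed.

(** The congruences between the coordinates of k make (k_i - k_(d+1)) / (d+1) an
integer; these quotients are the frequencies of phi_k in the coordinates of the
hyperplane, by [phase_RH_param]. *)
Lemma HH_coord k : HH k ->
  exists m : 'I_d -> int, forall i, tnth k (wd i) = tnth k ord_max + d.+1%:Z * m i.
Proof.
move=> [_ kmod]; exists (fun i => ((tnth k (wd i) - tnth k ord_max) %/ d.+1)%Z) => i.
rewrite [_%:Z * _]mulrC divzK ?subrKC//.
by rewrite -eqz_mod_dvd; apply/eqP/kmod.
Qed.

Lemma phase_RH_param k (m : 'I_d -> int) s :
  (forall i, tnth k (wd i) = tnth k ord_max + d.+1%:Z * m i) ->
  phase k (RH_param s) = 2 * pi * \sum_i (m i)%:~R * tnth s i.
Proof.
move=> km; rewrite /phase big_ord_recr /= (RH_paramE s).2 mulrN mulr_sumr.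
under eq_bigr => i _ do rewrite (RH_paramE s).1 km.
rewrite -sumrB (eq_bigr (fun i => d.+1%:R * ((m i)%:~R * tnth s i))).
  by rewrite -mulr_sumr mulrA divfK.
by move=> i _; rewrite rmorphD rmorphM /=; ring.
Qed.

Lemma cintegral_phi_eq0 k : HH k -> (exists i, tnth k i != 0) ->
  cintegral (surface R d) (@OmegaH R d) (phi k) = 0.
Proof.
move=> Hk [j kj]; have [m km] := HH_coord Hk.
have [i mi] : exists i, m i != 0.
  apply: contrapT => /forallNP h; have m0 i : m i = 0.
    by apply/eqP; apply: contrapT => /negP; exact: h.
  have kc i : tnth k i = tnth k ord_max.
    by have [->//|[l ->]] := ord_recrP i; rewrite km m0 mulr0 addr0.
  move: kj; have [+ _] := Hk; under eq_bigr do rewrite kc.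
  by rewrite sumr_const card_ord kc => /eqP; rewrite mulrn_eq0 => /eqP ->; rewrite eqxx.
rewrite /cintegral !Rintegral_surface.
- have -> : (fun t => complex.Re (phi k t)) \o @RH_param R d =
      (fun s => cos (2 * pi * \sum_i (m i)%:~R * tnth s i)).
    by apply/funext => s /=; rewrite -(phase_RH_param _ km).
  have -> : (fun t => complex.Im (phi k t)) \o @RH_param R d =
      (fun s => sin (2 * pi * \sum_i (m i)%:~R * tnth s i)).
    by apply/funext => s /=; rewrite -(phase_RH_param _ km).
  rewrite !(@periodic_Rintegral_eq0 _ _ _ _ _ i) ?mulr0//.
  + exact: measurable_OmegaH_param.
  + exact: fundamental_OmegaH_param.
  + exact: lebesgue_OmegaH_param.
  + exact: continuous_measurable_fun (@continuous_sin R).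
  + exact: sinDpi.
  + exact: sin_max.
  + exact: measurable_OmegaH_param.
  + exact: fundamental_OmegaH_param.
  + exact: lebesgue_OmegaH_param.
  + exact: continuous_measurable_fun (@continuous_cos R).
  + exact: cosDpi.
  + exact: cos_max.
- apply: (measurableT_comp (f := sin)); last exact: measurable_phase.
  exact: continuous_measurable_fun (@continuous_sin R).
- by move=> t; exact: sin_max.
- apply: (measurableT_comp (f := cos)); last exact: measurable_phase.
  exact: continuous_measurable_fun (@continuous_cos R).
- by move=> t; exact: cos_max.
Qed.

End phase.

(** * Linearity of the complex integral *)

Section cintegral.
Context {dT : measure_display} {T : measurableType dT} {R : realType}.
Variables (mu : {measure set T -> \bar R}) (D : set T) (mD : measurable D).
Implicit Types F G : T -> R[i].

Definition cintegrable F :=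
  mu.-integrable D (EFin \o (fun t => complex.Re (F t))) /\
  mu.-integrable D (EFin \o (fun t => complex.Im (F t))).

Lemma eq_cintegral F G : {in D, F =1 G} -> cintegral mu D F = cintegral mu D G.
Proof. by move=> FG; congr (_ +i* _); apply: eq_Rintegral => t /FG ->. Qed.

Let ReD (x y : R[i]) : complex.Re (x + y) = complex.Re x + complex.Re y.
Proof. by case: x => ? ?; case: y. Qed.
Let ImD (x y : R[i]) : complex.Im (x + y) = complex.Im x + complex.Im y.
Proof. by case: x => ? ?; case: y. Qed.
Let ReM (x y : R[i]) :
  complex.Re (x * y) = complex.Re x * complex.Re y - complex.Im x * complex.Im y.
Proof. by case: x => ? ?; case: y. Qed.
Let ImM (x y : R[i]) :
  complex.Im (x * y) = complex.Re x * complex.Im y + complex.Im x * complex.Re y.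
Proof. by case: x => ? ?; case: y. Qed.

Lemma cintegrable0 : cintegrable (fun=> 0).
Proof. by split; exact: integrable0. Qed.

Lemma cintegrableD F G : cintegrable F -> cintegrable G -> cintegrable (fun t => F t + G t).
Proof.
move=> [iRF iIF] [iRG iIG]; split.
  rewrite (_ : _ \o _ = (EFin \o (fun t => complex.Re (F t)))
      \+ (EFin \o (fun t => complex.Re (G t))))%E.
    exact: integrableD.
  by apply/funext => t /=; rewrite ReD.
rewrite (_ : _ \o _ = (EFin \o (fun t => complex.Im (F t)))
    \+ (EFin \o (fun t => complex.Im (G t))))%E.
  exact: integrableD.
by apply/funext => t /=; rewrite ImD.
Qed.

Let integrableRZ (u : T -> R) (r : R) : mu.-integrable D (EFin \o u) ->
  mu.-integrable D (EFin \o (fun t => r * u t)).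
Proof.
move=> iu; rewrite (_ : _ \o _ = fun t => r%:E * (EFin \o u) t)%E.
  exact: integrableZl.
by apply/funext => t.
Qed.

Lemma cintegrableZ a F : cintegrable F -> cintegrable (fun t => a * F t).
Proof.
move=> [iR iI]; split.
  rewrite (_ : _ \o _ = (EFin \o (fun t => (complex.Re a * complex.Re (F t))%R))
    \- (EFin \o (fun t => (complex.Im a * complex.Im (F t))%R)))%E.
    by apply: integrableB => //; exact: integrableRZ.
  by apply/funext => t /=; rewrite ReM.
rewrite (_ : _ \o _ = (EFin \o (fun t => (complex.Re a * complex.Im (F t))%R))
  \+ (EFin \o (fun t => (complex.Im a * complex.Re (F t))%R)))%E.
  by apply: integrableD => //; exact: integrableRZ.
by apply/funext => t /=; rewrite ImM.
Qed.

Lemma cintegralD F G : cintegrable F -> cintegrable G ->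
  cintegral mu D (fun t => F t + G t) = cintegral mu D F + cintegral mu D G.
Proof.
move=> [iRF iIF] [iRG iIG]; rewrite /cintegral.
under eq_Rintegral do rewrite ReD.
under [X in _ +i* X]eq_Rintegral do rewrite ImD.
by rewrite !RintegralD.
Qed.

Lemma cintegralZ a F : cintegrable F ->
  cintegral mu D (fun t => a * F t) = a * cintegral mu D F.
Proof.
move=> [iR iI]; rewrite /cintegral.
under eq_Rintegral do rewrite ReM.
under [X in _ +i* X]eq_Rintegral do rewrite ImM.
rewrite RintegralB//; [|exact: integrableRZ..].
rewrite RintegralD//; [|exact: integrableRZ..].
by rewrite !RintegralZl//; case: (a) => b c; simpc.
Qed.

Lemma cintegrable_sum (I : Type) (r : seq I) (F : I -> T -> R[i]) :
  (forall i, cintegrable (F i)) -> cintegrable (fun t => \sum_(i <- r) F i t).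
Proof.
move=> iF; elim: r => [|i r IHr].
  by under eq_fun do rewrite big_nil; exact: cintegrable0.
by under eq_fun do rewrite big_cons; exact: cintegrableD.
Qed.

Lemma cintegral_sum (I : Type) (r : seq I) (F : I -> T -> R[i]) :
  (forall i, cintegrable (F i)) ->
  cintegral mu D (fun t => \sum_(i <- r) F i t) = \sum_(i <- r) cintegral mu D (F i).
Proof.
move=> iF; elim: r => [|i r IHr].
  under eq_fun do rewrite big_nil; rewrite big_nil.
  by rewrite /cintegral /= !Rintegral_cst// !mul0r.
under eq_fun do rewrite big_cons; rewrite big_cons cintegralD ?IHr//.
exact: cintegrable_sum.
Qed.

End cintegral.

(** * Algebra of the exponentials *)

Section phi.
Variables (R : realType) (d : nat).
Implicit Types (k m : d.+1.-tuple int) (t : Rn R d.+1).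

Definition ksub k m : d.+1.-tuple int := [tuple tnth k i - tnth m i | i < d.+1].

Lemma phase_ksub k m t : phase (ksub k m) t = phase k t - phase m t.
Proof.
rewrite /phase -mulrBr -sumrB; congr (_ * _); apply: eq_bigr => i _.
by rewrite tnth_mktuple rmorphB mulrBl.
Qed.

Lemma phi_ksub k m t : phi (ksub k m) t = phi k t * (phi m t)^*.
Proof.
rewrite !phiE phase_ksub cosB sinB; simpc.
by congr (_ +i* _); ring.
Qed.

Lemma phase_tshift k v t : phase k (tshift v t) = phase k t + phase k v.
Proof.
rewrite /phase -mulrDr -big_split /=; congr (_ * _); apply: eq_bigr => i _.
by rewrite tnth_mktuple mulrDr.
Qed.

Lemma phi_tshift k v t : phi k (tshift v t) = phi k v * phi k t.
Proof.
rewrite !phiE phase_tshift cosD sinD; simpc.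
by congr (_ +i* _); ring.
Qed.

Lemma HH_ksub k m : HH k -> HH m -> HH (ksub k m).
Proof.
move=> [k0 kd] [m0 md]; split=> [|i j].
  by under eq_bigr do rewrite tnth_mktuple; rewrite sumrB k0 m0 subr0.
apply/eqP; rewrite !tnth_mktuple eqz_mod_dvd.
rewrite (_ : _ - _ = (tnth k i - tnth k j) - (tnth m i - tnth m j)); last by ring.
by rewrite rpredB// -eqz_mod_dvd; apply/eqP.
Qed.

(** Since z has sum zero, k . z = sum_i (k_i - k_0) z_i, in which d+1 divides
each term. *)
Lemma phi_lattice k (z : d.+1.-tuple int) :
  HH k -> \sum_i tnth z i = 0 -> phi k (ivec R z) = 1.
Proof.
move=> [_ kd] z0.
(* the phase is 2 pi times the integer q *)
have [q qE] : exists q : int, phase k (ivec R z) = 0 + pi *+ 2 * q%:~R.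
  exists (\sum_i ((tnth k i - tnth k ord0) %/ d.+1)%Z * tnth z i).
  rewrite add0r /phase.
  have -> : \sum_i (tnth k i)%:~R * tnth (ivec R z) i =
      \sum_i (tnth k i - tnth k ord0)%:~R * (tnth z i)%:~R.
    under [RHS]eq_bigr do rewrite rmorphB mulrBl.
    rewrite sumrB -mulr_sumr -rmorph_sum z0 /= mulr0 subr0.
    by apply: eq_bigr => i _; rewrite tnth_mktuple.
  rewrite -[pi *+ 2]mulr_natl -mulrA; congr (_ * _).
  rewrite rmorph_sum !mulr_sumr /=; apply: eq_bigr => i _.
  rewrite -{1}[tnth k i - _](@divzK d.+1); last by rewrite -eqz_mod_dvd; apply/eqP/kd.
  by rewrite !rmorphM /=; field.
by rewrite phiE qE (periodicz (@cosD2pi R)) (periodicz (@sinD2pi R)) cos0 sin0.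
Qed.

Lemma cintegrable_phi k : cintegrable (surface R d) (@OmegaH R d) (phi k).
Proof.
split.
- apply: integrable_surface => [|t]; last exact: cos_max.
  apply: (measurableT_comp (f := cos)); last exact: measurable_phase.
  exact: continuous_measurable_fun (@continuous_cos R).
- apply: integrable_surface => [|t]; last exact: sin_max.
  apply: (measurableT_comp (f := sin)); last exact: measurable_phase.
  exact: continuous_measurable_fun (@continuous_sin R).
Qed.

Lemma mean_OmegaH_phi k : HH k ->
  ((Num.sqrt d.+1%:R)^-1)%:C * cintegral (surface R d) (@OmegaH R d) (phi k) =
  [forall i, tnth k i == 0]%:R.
Proof.
move=> Hk; case: forallP => [k0|]; last first.
  move=> /existsNP[i ki]; rewrite cintegral_phi_eq0 ?mulr0//.
  by exists i; apply/negP.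
have ph t : phase k t = 0.
  by rewrite /phase big1 ?mulr0// => i _; rewrite (eqP (k0 i)) mul0r.
rewrite (_ : cintegral _ _ _ = (Num.sqrt d.+1%:R)%:C).
  by rewrite -rmorphM /= mulVf// sqrtr_eq0 -ltNge ltr0n.
have mO := @measurable_OmegaH R d.
rewrite /cintegral; congr (_ +i* _).
  under eq_Rintegral do rewrite phiE ph cos0 /=.
  by rewrite Rintegral_cst// mul1r; exact: (congr1 fine (surface_OmegaH R d)).
under eq_Rintegral do rewrite phiE ph sin0 /=.
by rewrite Rintegral_cst// mul0r.
Qed.

End phi.

(** * The finite group of nodes *)

(** With r = a mod M, the identity cos (2x) = 1 - 2 sin^2 x at x = pi r / M
forces sin x = 0, while 0 <= x < pi; so x = 0 and r = 0. *)
Lemma cos_eq1_dvd (R : realType) (M : nat) (a : int) : (0 < M)%N ->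
  cos (2 * pi * (a%:~R / M%:R)) = 1 :> R -> (M %| a)%Z.
Proof.
move=> M0; have M0' : 0 < M%:R :> R by rewrite ltr0n.
pose r := (a %% M)%Z; have rM : 0 <= r < M%:Z.
  by rewrite modz_ge0 ?ltz_pmod// -lt0n.
have -> : 2 * pi * (a%:~R / M%:R) =
    2 * pi * (r%:~R / M%:R) + pi *+ 2 * (a %/ M)%Z%:~R :> R.
  rewrite {1}(divz_eq a M) rmorphD rmorphM /= -/r -pmulrn; field.
  by rewrite gt_eqF.
rewrite (periodicz (@cosD2pi R)) => c1; apply/dvdz_mod0P; rewrite -/r; apply/eqP.
apply: contraT => r0; pose x : R := pi * (r%:~R / M%:R).
have rM0 : 0 < r%:~R / M%:R :> R by rewrite divr_gt0// ltr0z lt_def r0; case/andP: rM.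
have rM1 : r%:~R / M%:R < 1 :> R.
  by rewrite ltr_pdivrMr// mul1r -[M%:R]/(M%:Z%:~R) ltr_int; case/andP: rM.
have : 0 < sin x.
  have p0 := pi_gt0 R; apply: sin_gt0_pi; rewrite /x mulr_gt0//=.
  by rewrite -[ltRHS]mulr1 ltr_pM2l.
have := cos_mulr2n x; rewrite cos2sin2 (_ : x *+ 2 = 2 * pi * (r%:~R / M%:R)); last first.
  by rewrite mulr2n /x; ring.
rewrite c1 => h s0; have : 0 < sin x ^+ 2 by rewrite exprn_gt0.
by move: h; rewrite -mulr_natl; lra.
Qed.

Section discrete.
Variables (R : realType) (d n : nat).
Hypothesis n0 : (0 < n)%N.
Implicit Types (k v q : d.+1.-tuple int) (A : {set 'I_d.+1}).
Notation HHn := (@HHn R d n).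
Notation HHstar := (@HHstar R d n).
Notation node := (@node R d n).
Let wd := widen_ord (leqnSn d).
Let M := (d.+1 * n)%N.
Let M0 : (0 < M)%N. Proof. by rewrite muln_gt0. Qed.
Let MR0 : 0 < M%:R :> R. Proof. by rewrite ltr0n. Qed.

(** Between elements of [HH], this is congruence modulo the lattice (d+1) n A: the
integral quotient of the difference has sum zero by [congMP]. *)
Definition congM k k' := [forall i, (tnth k i == tnth k' i %[mod M])%Z].

Lemma congM_sym k k' : congM k k' = congM k' k.
Proof. by apply: eq_forallb => i; rewrite eq_sym. Qed.

Lemma congM_trans k2 k1 k3 : congM k1 k2 -> congM k2 k3 -> congM k1 k3.
Proof.
move=> /forallP h1 /forallP h2; apply/forallP => i.
by rewrite (eqP (h1 i)).
Qed.

Lemma congMP k k' : HH k -> HH k' -> congM k k' ->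
  exists z : d.+1.-tuple int, \sum_i tnth z i = 0 /\
    forall i, tnth k' i = tnth k i + M%:Z * tnth z i.
Proof.
move=> [k0 _] [k'0 _] /forallP kk'.
pose z := [tuple ((tnth k' i - tnth k i) %/ M)%Z | i < d.+1].
have zE i : tnth k' i = tnth k i + M%:Z * tnth z i.
  rewrite tnth_mktuple mulrC divzK ?subrKC//.
  by rewrite -eqz_mod_dvd eq_sym; exact: kk'.
exists z; split=> //.
move: k'0; under eq_bigr do rewrite zE.
rewrite big_split /= k0 add0r -mulr_sumr => /eqP; rewrite mulf_eq0 => /predU1P[|/eqP//].
by have := M0; lia.
Qed.

Lemma node_diff k i j : tnth (node k) i - tnth (node k) j = @kdiff R d k i j / n%:R.
Proof.
by rewrite !tnth_mktuple /kdiff rmorphB /= natrM invfM !mulrBl mulrA mulrA.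
Qed.

Lemma RH_node k : HH k -> RH R d (node k).
Proof.
move=> [k0 _]; rewrite /RH /=; under eq_bigr do rewrite tnth_mktuple.
by rewrite -mulr_suml -rmorph_sum k0 /= mul0r.
Qed.

Lemma HHnE k : HH k -> HHn k <-> OmegaH (node k).
Proof.
move=> Hk; have nR : 0 < n%:R :> R by rewrite ltr0n.
have E i j : (-1 < tnth (node k) i - tnth (node k) j <= 1) =
    (- n%:R < @kdiff R d k i j <= n%:R).
  by rewrite node_diff ltr_pdivlMr// ler_pdivrMr// mulN1r mul1r.
split=> [[_ h]|[_ h]]; split=> //; first exact: RH_node.
  by move=> i j ij; rewrite E; exact: h.
by move=> i j ij; rewrite -E; exact: h.
Qed.

Definition addM k (z : 'I_d.+1 -> int) : d.+1.-tuple int :=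
  [tuple tnth k i + M%:Z * z i | i < d.+1].

Lemma congM_addM k z : congM k (addM k z).
Proof.
by apply/forallP => i; rewrite tnth_mktuple eq_sym eqz_mod_dvd addrC addKr dvdz_mulr.
Qed.

Lemma HH_addM k z : HH k -> \sum_i z i = 0 -> HH (addM k z).
Proof.
move=> [k0 kd] z0; split=> [|i j].
  by under eq_bigr do rewrite tnth_mktuple; rewrite big_split /= k0 -mulr_sumr z0 mulr0.
apply/eqP; rewrite !tnth_mktuple eqz_mod_dvd.
rewrite (_ : _ - _ = (tnth k i - tnth k j) + M%:Z * (z i - z j)); last by ring.
by rewrite rpredD -?eqz_mod_dvd ?(kd i j)// /M PoszM -mulrA dvdz_mulr.
Qed.

Lemma node_addM k (z : d.+1.-tuple int) :
  node (addM k (tnth z)) = tshift (ivec R z) (node k).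
Proof.
apply: eq_from_tnth => i; rewrite !tnth_mktuple rmorphD mulrDl; congr (_ + _).
by rewrite rmorphM /= -pmulrn mulrAC divff ?mul1r// gt_eqF.
Qed.

Lemma HHn_exists k : HH k -> exists k', HHn k' /\ congM k k'.
Proof.
move=> Hk; have [z [z0 zO]] := OmegaH_exists (RH_node Hk).
have Hk' := HH_addM Hk z0.
exists (addM k z); split; last exact: congM_addM.
apply/(HHnE Hk'); rewrite (_ : addM _ _ = addM k (tnth [tuple z i | i < d.+1])).
  rewrite node_addM (_ : tshift _ _ = [tuple tnth (node k) i + (z i)%:~R | i < d.+1])//.
  by apply: eq_from_tnth => i; rewrite !tnth_mktuple.
by apply: eq_from_tnth => i; rewrite !tnth_mktuple.
Qed.

Lemma congM_addE k k' : HH k -> HH k' -> congM k k' ->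
  exists z : d.+1.-tuple int, \sum_i tnth z i = 0 /\ k' = addM k (tnth z).
Proof.
move=> Hk Hk' /(congMP Hk Hk')[z [z0 zE]]; exists z; split=> //.
by apply: eq_from_tnth => i; rewrite zE !tnth_mktuple.
Qed.

Lemma HHn_unique k k' : HHn k -> HHn k' -> congM k k' -> k = k'.
Proof.
move=> Hk Hk' /(congM_addE Hk.1 Hk'.1)[z [z0 kz]].
have := OmegaH_unique (z := tnth z) ((HHnE Hk.1).1 Hk) ((HHnE Hk'.1).1 Hk').
rewrite kz node_addM => zE; apply: eq_from_tnth => i.
by rewrite tnth_mktuple zE ?mulr0 ?addr0// => l; rewrite !tnth_mktuple.
Qed.

(** For k in [HH], the point of [HHn] in the class of k; the tiling at the node of
k provides it. *)
Definition rep k := xget k [set k' | HHn k' /\ congM k k'].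

Lemma repP k : HH k -> HHn (rep k) /\ congM k (rep k).
Proof. by move=> /HHn_exists kk'; exact: (xgetPex k kk'). Qed.

Lemma rep_eq k k' : HH k -> HHn k' -> congM k k' -> rep k = k'.
Proof.
move=> Hk Hk' kk'; have [Hr kr] := repP Hk.
by apply: HHn_unique => //; rewrite (congM_trans _ kk')// congM_sym.
Qed.

Lemma phi_node_congM q k k' : HH q -> HH k -> HH k' -> congM k k' ->
  phi q (node k') = phi q (node k).
Proof.
move=> Hq Hk Hk' /(congM_addE Hk Hk')[z [z0 ->]].
by rewrite node_addM phi_tshift phi_lattice ?mul1r.
Qed.

Definition kadd k v : d.+1.-tuple int := [tuple tnth k i + tnth v i | i < d.+1].

Lemma HH_kadd k v : HH k -> HH v -> HH (kadd k v).
Proof.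
move=> [k0 kd] [m0 md]; split=> [|i j].
  by under eq_bigr do rewrite tnth_mktuple; rewrite big_split /= k0 m0 addr0.
apply/eqP; rewrite !tnth_mktuple eqz_mod_dvd.
rewrite (_ : _ - _ = (tnth k i - tnth k j) + (tnth v i - tnth v j)); last by ring.
by rewrite rpredD// -eqz_mod_dvd; apply/eqP.
Qed.

Lemma node_kadd k v : node (kadd k v) = tshift (node v) (node k).
Proof. by apply: eq_from_tnth => i; rewrite !tnth_mktuple rmorphD mulrDl. Qed.

Lemma congM_kadd k k' v : congM (kadd k v) (kadd k' v) = congM k k'.
Proof.
apply: eq_forallb => i; rewrite !tnth_mktuple !eqz_mod_dvd.
by rewrite (_ : _ + _ - _ = tnth k i - tnth k' i)//; ring.
Qed.

(** Translation by v permutes the classes. *)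
Lemma sum_HHn_shift (F : d.+1.-tuple int -> R[i]) v : HH v ->
  \sum_(k \in HHn) F (rep (kadd k v)) = \sum_(k \in HHn) F k.
Proof.
move=> Hv; apply/esym; apply: reindex_fsbig; split.
- by move=> k Hk; have [] := repP (HH_kadd Hk.1 Hv).
- move=> k k' /set_mem Hk /set_mem Hk' kk'.
  have [_ c] := repP (HH_kadd Hk.1 Hv); have [_ c'] := repP (HH_kadd Hk'.1 Hv).
  apply: HHn_unique => //; rewrite -(congM_kadd _ _ v).
  by apply: congM_trans c _; rewrite kk' congM_sym.
- move=> k Hk; pose w := ksub k v.
  have Hw : HH w by exact: HH_ksub Hk.1 Hv.
  have [Hr cr] := repP Hw; exists (rep w) => //.
  apply: rep_eq => //; first exact: HH_kadd Hr.1 Hv.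
  rewrite (_ : k = kadd w v); first by rewrite congM_kadd congM_sym.
  by apply: eq_from_tnth => i; rewrite !tnth_mktuple subrK.
Qed.

(** The elements (d+1) e_i - (1, ..., 1) of [HH] separate the characters: on
the node of [evec i] the phase of phi_k depends on k_i alone. *)
Definition evec i : d.+1.-tuple int := [tuple d.+1%:Z * (l == i)%:R - 1 | l < d.+1].

Lemma HH_evec i : HH (evec i).
Proof.
split=> [|l m].
  under eq_bigr do rewrite tnth_mktuple.
  rewrite sumrB -mulr_sumr (bigD1 i)//= big1 => [|l /negbTE->//].
  by rewrite eqxx addr0 mulr1 sumr_const card_ord natz subrr.
apply/eqP; rewrite !tnth_mktuple eqz_mod_dvd opprB addrA subrK.
by rewrite -mulrBr dvdz_mulr.
Qed.

Lemma phase_evec k i : HH k ->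
  phase k (node (evec i)) = 2 * pi * ((tnth k i)%:~R / M%:R).
Proof.
move=> [k0 _]; rewrite /phase.
rewrite (eq_bigr (fun l => d.+1%:R * (l == i)%:R * ((tnth k l)%:~R / M%:R) -
    (tnth k l)%:~R / M%:R)).
  rewrite sumrB -[X in _ - X]mulr_suml -rmorph_sum k0 /= mul0r subr0.
  rewrite (bigD1 i)//= big1 => [|l /negbTE->]; last by rewrite mulr0 mul0r.
  by rewrite eqxx addr0 mulr1 [LHS]mulrA divfK.
by move=> l _; rewrite !tnth_mktuple rmorphB rmorphM /= -!pmulrn; ring.
Qed.

(** If the character of q = k - k' were trivial, its values at the nodes of the
[evec i] would make (d+1) n divide each q_i, that is, k and k' would be
congruent.  Otherwise some shift multiplies the sum by a number other than 1. *)
Lemma sum_HHn_phi_eq0 k k' : HHn k -> HHn k' -> k != k' ->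
  \sum_(j \in HHn) phi (ksub k k') (node j) = 0.
Proof.
move=> Hk Hk' kk'; set q := ksub k k'.
have Hq : HH q := HH_ksub Hk.1 Hk'.1.
(* a shift on which the character is not trivial *)
have [v [Hv v1]] : exists v, HH v /\ phi q (node v) != 1.
  apply: contrapT => /forallNP h; move: kk'; apply/negP; rewrite negbK; apply/eqP.
  apply: HHn_unique => //; apply/forallP => i; rewrite eqz_mod_dvd.
  have := h (evec i); rewrite not_andP => -[/(_ (HH_evec i))//|/negP].
  rewrite negbK phiE phase_evec// => /eqP[c1 _].
  by have := cos_eq1_dvd M0 c1; rewrite tnth_mktuple.
have := sum_HHn_shift (fun j => phi q (node j)) Hv.
rewrite (eq_fsbigr (fun j => phi q (node v) * phi q (node j))); last first.
  move=> j /set_mem Hj; have Hjv := HH_kadd Hj.1 Hv; have [Hr cr] := repP Hjv.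
  by rewrite (phi_node_congM Hq Hjv Hr.1 cr) node_kadd phi_tshift.
rewrite -mulr_fsumr => /eqP; rewrite -subr_eq0 -{2}[\sum_(_ \in _) _]mul1r -mulrBl.
by rewrite mulf_eq0 subr_eq0 (negbTE v1) => /eqP.
Qed.


(** * The number of nodes *)

(** Representatives that are easy to count: the first d coordinates of an element
of [HH], which are congruent modulo d+1, are reduced modulo (d+1) n and written
r + (d+1) a_i with r < d+1 and a_i < n; the sum fixes the last one. *)
Definition boxpt (p : 'I_d.+1 * {ffun 'I_d -> 'I_n}) : d.+1.-tuple int :=
  [tuple if insub (l : nat) is Some i then (p.1 + d.+1 * p.2 i)%:Z
         else - \sum_(i < d) (p.1 + d.+1 * p.2 i)%:Z | l < d.+1].

Lemma boxpt_wd p i : tnth (boxpt p) (wd i) = (p.1 + d.+1 * p.2 i)%:Z.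
Proof.
rewrite tnth_mktuple /=; case: insubP => [j _ ji|]; last by rewrite ltn_ord.
by rewrite (val_inj ji : j = i).
Qed.

Lemma boxpt_max p : tnth (boxpt p) ord_max = - \sum_(i < d) (p.1 + d.+1 * p.2 i)%:Z.
Proof. by rewrite tnth_mktuple /= insubN// ltnn. Qed.

Lemma HH_boxpt p : HH (boxpt p).
Proof.
split.
  rewrite big_ord_recr /= boxpt_max (eq_bigr (fun i => (p.1 + d.+1 * p.2 i)%:Z)).
    by rewrite subrr.
  by move=> i _; exact: boxpt_wd.
suff E i : (tnth (boxpt p) i = p.1 %[mod d.+1])%Z by move=> i j; rewrite !E.
have [->|[l ->]] := ord_recrP i; apply/eqP; rewrite eqz_mod_dvd; last first.
  by rewrite boxpt_wd PoszD addrC addKr PoszM dvdz_mulr.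
rewrite boxpt_max (_ : _ - _ = - (d.+1%:Z * (p.1%:Z + \sum_(i < d) (p.2 i)%:Z))).
  by rewrite rpredN dvdz_mulr.
under eq_bigr do rewrite PoszD PoszM.
rewrite big_split /= -mulr_sumr sumr_const card_ord -mulr_natr natz [in RHS]intS.
by ring.
Qed.

(** The residue r is read off the first coordinate modulo d+1, and the a_i are then
the quotients. *)
Lemma boxpt_congM_inj p p' : (0 < d)%N -> congM (boxpt p) (boxpt p') -> p = p'.
Proof.
move=> d0 /forallP c.
have small (q : 'I_d.+1 * {ffun 'I_d -> 'I_n}) i : (q.1 + d.+1 * q.2 i < M)%N.
  apply: (@leq_trans (d.+1 + d.+1 * q.2 i)); first by rewrite ltn_add2r.
  by rewrite -mulnS leq_mul2l /=.
have E i : (p.1 + d.+1 * p.2 i)%N = (p'.1 + d.+1 * p'.2 i)%N.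
  have := c (wd i); rewrite !boxpt_wd !modz_nat eqz_nat !modn_small; [|exact: small..].
  by move/eqP.
have E1 : p.1 = p'.1.
  have := congr1 (modn^~ d.+1) (E (Ordinal d0)).
  rewrite /= ![(d.+1 * _)%N]mulnC ![(_ + _ * d.+1)%N]addnC !modnMDl !modn_small//.
  exact: val_inj.
move: E1 E; case: p c => [r a] _; case: p' => [r' a'] /= -> E.
congr pair; apply/ffunP => i; apply: val_inj.
by have /eqP := E i; rewrite eqn_add2l eqn_mul2l /= => /eqP.
Qed.

Lemma boxpt_congM_surj k : HH k -> exists p, congM (boxpt p) k.
Proof.
move=> Hk; pose r := (tnth k ord_max %% d.+1)%Z.
have r0 : 0 <= r by rewrite modz_ge0.
have rN : (absz r < d.+1)%N by rewrite -ltz_nat gez0_abs// ltz_pmod.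
pose a i := ((tnth k (wd i) %/ d.+1)%Z %% n)%Z.
have nZ : (n%:Z != 0) by rewrite eqz_nat -lt0n.
have a0 i : 0 <= a i by rewrite modz_ge0.
have aN i : (absz (a i) < n)%N by rewrite -ltz_nat gez0_abs// ltz_pmod// ltz_nat.
pose p := (Ordinal rN, [ffun i => Ordinal (aN i)]).
exists p.
(* the last coordinate follows from these, both sums being zero *)
have cE i : (tnth (boxpt p) (wd i) == tnth k (wd i) %[mod M])%Z.
  rewrite boxpt_wd /p /= ffunE /= PoszD PoszM !gez0_abs//.
  rewrite eqz_mod_dvd; have := divz_eq (tnth k (wd i)) d.+1.
  rewrite -(Hk.2 ord_max (wd i)) -/r => ->.
  have := divz_eq (tnth k (wd i) %/ d.+1)%Z n; rewrite -/(a i) => {1}->.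
  rewrite (_ : _ - _ =
    - (((tnth k (wd i) %/ d.+1)%Z %/ n)%Z * (d.+1%:Z * n%:Z))); last by ring.
  by rewrite rpredN /M PoszM dvdz_mull.
apply/forallP => j; have [->|[i ->]] := ord_recrP j; last exact: cE.
have sumE q : HH q -> tnth q ord_max = - \sum_(i < d) tnth q (wd i).
  by move=> [+ _]; rewrite big_ord_recr /= addrC => /eqP; rewrite addr_eq0 => /eqP.
rewrite (sumE _ (HH_boxpt p)) (sumE _ Hk) eqz_mod_dvd -opprB opprK addrC -sumrB.
rewrite -rpredN opprK ?rpred_sum// => i _.
by rewrite -eqz_mod_dvd.
Qed.

Lemma perm_HHn : (0 < d)%N -> perm_eq (fset_set HHn)
  [seq rep (boxpt p) | p <- enum {: 'I_d.+1 * {ffun 'I_d -> 'I_n}}].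
Proof.
move=> d0; apply: uniq_perm; first exact: fset_uniq.
- rewrite map_inj_uniq ?enum_uniq// => p p' pp'; apply: boxpt_congM_inj => //.
  have [_ c] := repP (HH_boxpt p); have [_ c'] := repP (HH_boxpt p').
  by apply: congM_trans c _; rewrite pp' congM_sym.
- move=> k; rewrite in_fset_set; last exact: finite_HHn.
  apply/idP/mapP => [/set_mem Hk|[p _ ->]]; last first.
    by apply/mem_set; have [] := repP (HH_boxpt p).
  have [p pk] := boxpt_congM_surj Hk.1; exists p; first by rewrite mem_enum.
  by apply/esym; apply: rep_eq => //; exact: HH_boxpt.
Qed.

Lemma size_HHn : (0 < d)%N -> size (fset_set HHn) = (d.+1 * n ^ d)%N.
Proof.
by move=> d0; rewrite (perm_size (perm_HHn d0)) size_map -cardE card_prod card_ffun !card_ord.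
Qed.


(** * Weights on the closed polytope *)

Lemma kdiff_le k i j : (@kdiff R d k i j <= n%:R) = (tnth k i - tnth k j <= M%:Z).
Proof.
by rewrite /kdiff ler_pdivrMr// -natrM mulnC -[_%:R]/((d.+1 * n)%N%:Z%:~R) ler_int.
Qed.

Lemma kdiff_lt k i j : (@kdiff R d k i j < n%:R) = (tnth k i - tnth k j < M%:Z).
Proof.
by rewrite /kdiff ltr_pdivrMr// -natrM mulnC -[_%:R]/((d.+1 * n)%N%:Z%:~R) ltr_int.
Qed.

Lemma kdiffC k i j : @kdiff R d k i j = - @kdiff R d k j i.
Proof. by rewrite /kdiff -mulNr -rmorphN /= opprB. Qed.

Lemma HHstarE k : HHstar k <-> HH k /\ forall i j, tnth k i - tnth k j <= M%:Z.
Proof.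
split=> -[Hk h]; split=> // i j.
  have [ij|ji|/val_inj->] := ltngtP i j; last by rewrite subrr.
  - by have /andP[_] := h _ _ ij; rewrite kdiff_le.
  - by have /andP[+ _] := h _ _ ji; rewrite kdiffC lerN2 kdiff_le.
by move=> _; apply/andP; split; first rewrite kdiffC lerN2; rewrite kdiff_le; exact: h.
Qed.

Lemma HHintE k : @HHint R d n k <-> HH k /\ forall i j, tnth k i - tnth k j < M%:Z.
Proof.
split=> -[Hk h]; split=> // i j.
  have [ij|ji|/val_inj->] := ltngtP i j; last by rewrite subrr ltz_nat.
  - by have /andP[_] := h _ _ ij; rewrite kdiff_lt.
  - by have /andP[+ _] := h _ _ ji; rewrite kdiffC ltrN2 kdiff_lt.
by move=> _; apply/andP; split; first rewrite kdiffC ltrN2; rewrite kdiff_lt; exact: h.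
Qed.

(** For k in [HHstar], no difference of coordinates exceeds (d+1) n.  The
conditions below single out the coordinates that reach it, as the larger or as
the smaller one; when there are any, these are the sets I and J for which the
node of k lies in [BB I J]. *)
Definition high k : {set 'I_d.+1} :=
  finset (fun l => [exists m, tnth k l - tnth k m == M%:Z]).
Definition low k : {set 'I_d.+1} :=
  finset (fun l => [exists m, tnth k m - tnth k l == M%:Z]).

Definition extremal k : {set 'I_d.+1} := (high k :|: low k)%SET.

Lemma highP k l : reflect (exists m, tnth k l - tnth k m = M%:Z) (l \in high k).
Proof. by rewrite inE; apply: 'exists_eqP. Qed.

Lemma lowP k l : reflect (exists m, tnth k m - tnth k l = M%:Z) (l \in low k).
Proof. by rewrite inE; apply: 'exists_eqP. Qed.

Lemma high_low_diff k i j : HHstar k -> i \in high k -> j \in low k ->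
  tnth k i - tnth k j = M%:Z.
Proof.
move=> /HHstarE[_ h] /highP[m im] /lowP[m' m'j].
by have := h i j; have := h m' m; lia.
Qed.

Lemma disjoint_high_low k : HHstar k -> [disjoint high k & low k]%bool.
Proof.
move=> Hk; apply/pred0P => l /=; apply/negP => /andP[lt lb].
by have := high_low_diff Hk lt lb; have := M0; lia.
Qed.

Lemma in_extremal k l : (l \in extremal k) = (l \in high k) || (l \in low k).
Proof. exact: finset.in_setU. Qed.

Lemma high_sub_extremal k : high k \subset extremal k.
Proof. exact: finset.subsetUl. Qed.

Lemma card_extremal k : HHstar k -> (#|extremal k| = #|high k| + #|low k|)%N.
Proof. by move=> /disjoint_high_low; rewrite -leq_card_setU => /eqP. Qed.

(** For a point of [HHint] both sets are empty and the binomial coefficient is 1,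
so one formula covers the two kinds of points. *)
Lemma weight_star k : HHstar k ->
  weight R n k = ('C(#|extremal k|, #|high k|)%:R)^-1.
Proof.
move=> Hk; rewrite card_extremal//; have [Hint|Hint] := pselect (HHint R n k).
  rewrite weight_HHint// (_ : high k = finset.set0) ?cards0 ?bin0 ?invr1//.
  apply/setP => l; rewrite [RHS]inE; apply/negbTE/negP => /highP[m].
  by have := (HHintE k).1 Hint; move=> [_ /(_ l m)]; lia.
have [i [j ij]] : exists i j, tnth k i - tnth k j = M%:Z.
  apply: contrapT => h; apply: Hint; apply/HHintE; split; first by case: Hk.
  move=> i j; rewrite lt_neqAle (((HHstarE k).1 Hk).2 i j) andbT.
  by apply/eqP => ij; apply: h; exists i, j.
apply: weight_HHij.
- by apply/card_gt0P; exists i; apply/highP; exists j.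
- by apply/card_gt0P; exists j; apply/lowP; exists i.
- by rewrite -card_extremal// -[leqRHS]card_ord max_card.
- split; first by case: Hk.
  exists (high k), (low k); split=> //; first exact: disjoint_high_low.
  split; first by apply: RH_node; case: Hk.
  have MR : 0 < M%:R :> R by rewrite ltr0n.
  move=> i' j' it jb; have ij' := high_low_diff Hk it jb; split=> [|l].
    rewrite !tnth_mktuple -/M (_ : tnth k j' = tnth k i' - M%:Z); last by rewrite -ij'; ring.
    by rewrite rmorphB /= mulrBl -pmulrn divff// gt_eqF.
  rewrite -/(extremal k) in_extremal negb_or => /andP[lt lb].
  rewrite !tnth_mktuple -/M !ltr_pM2r ?invr_gt0//.
  rewrite !ltr_int; have [_ h] := (HHstarE k).1 Hk; apply/andP; split.
    have := h i' l; rewrite le_eqVlt => /predU1P[il|]; last by lia.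
    by case/negP: lb; apply/lowP; exists i'.
  have := h l j'; rewrite le_eqVlt => /predU1P[lj|]; last by lia.
  by case/negP: lt; apply/highP; exists j'.
Qed.

(** All the high coordinates are equal, and all the low ones are (d+1) n below
them.  Adding or subtracting (d+1) n therefore redistributes the two values over
the same positions, and [A] says where the upper one goes. *)
Definition rehigh k A : d.+1.-tuple int :=
  addM k (fun l => (l \in A)%:R - (l \in high k)%:R).

Lemma congM_rehigh k A : congM k (rehigh k A).
Proof. exact: congM_addM. Qed.

Lemma sum_mem (A : {set 'I_d.+1}) : \sum_i (i \in A)%:R = #|A|%:Z.
Proof. by rewrite -natr_sum -[X in X%:R]big_mkcond /= sum1_card natz. Qed.

(** Let k' = k + (d+1) n z.  If z is not zero, it is positive at some a and
negative at some b; as neither k nor k' has differences beyond (d+1) n, this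
forces z_a = 1, z_b = -1, with a low and b high in k and the converse in k'.  So
z only exchanges high and low coordinates, and where z vanishes the status of a
coordinate does not change. *)
Lemma fibre_high k k' : HHstar k -> HHstar k' -> congM k k' ->
  [/\ k' = rehigh k (high k'), #|high k'| = #|high k| &
      extremal k' = extremal k].
Proof.
move=> Hk Hk' c; have [z [z0 zE]] := congMP Hk.1 Hk'.1 c.
have [_ h] := (HHstarE k).1 Hk; have [_ h'] := (HHstarE k').1 Hk'.
(* z_a - z_b >= 2 already exhausts the range from -(d+1) n to (d+1) n *)
have pos_neg a b : 0 < tnth z a -> tnth z b < 0 ->
    [/\ tnth z a = 1, tnth z b = -1, a \in low k /\ b \in high k &
        a \in high k' /\ b \in low k'].
  move=> za zb; have := h' a b; have := h b a; rewrite !zE => h1 h2.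
  have hz : M%:Z * (tnth z a - tnth z b) <= M%:Z * 2 by lia.
  rewrite ler_pM2l in hz; last by rewrite ltz_nat.
  have [za1 zb1] : tnth z a = 1 /\ tnth z b = -1 by lia.
  have e : tnth k b - tnth k a = M%:Z by move: h2; rewrite za1 zb1; lia.
  have e' : tnth k' a - tnth k' b = M%:Z by rewrite !zE za1 zb1; lia.
  split=> //; split.
  - by apply/lowP; exists b.
  - by apply/highP; exists a.
  - by apply/highP; exists b.
  - by apply/lowP; exists a.
have [zz|[a [b [za zb]]]] := int_sum0_signs z0.
- have -> : k' = k by apply: eq_from_tnth => l; rewrite zE zz mulr0 addr0.
  split=> //; apply: eq_from_tnth => l; rewrite tnth_mktuple subrr mulr0 addr0//.
have [za1 zb1 [ak bk] [ak' bk']] := pos_neg _ _ za zb.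
have kE l : l \in high k -> tnth k l = tnth k b.
  by move=> lk; have := high_low_diff Hk lk ak; have := high_low_diff Hk bk ak; lia.
have mem l : [/\ tnth z l = (l \in high k')%:R - (l \in high k)%:R &
    (l \in extremal k') = (l \in extremal k)].
  have dk := disjointFl (disjoint_high_low Hk).
  have dk' := disjointFl (disjoint_high_low Hk').
  rewrite !in_extremal; have [zl|zl|zl] := ltgtP (tnth z l) 0.
  - have [_ -> [_ lt] [_ lb']] := pos_neg _ _ za zl.
    by rewrite lt lb' (dk' _ lb') orbT.
  - have [-> _ [lb _] [lt' _]] := pos_neg _ _ zl zb.
    by rewrite lb lt' (dk _ lb) orbT.
  have ab := high_low_diff Hk bk ak.
  have kl : tnth k' l = tnth k l by rewrite zE zl mulr0 addr0.
  have ka : tnth k' a = tnth k a + M%:Z by rewrite zE za1 mulr1.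
  have kb : tnth k' b = tnth k b - M%:Z by rewrite zE zb1 mulrN1.
  have tt : (l \in high k') = (l \in high k).
    apply/idP/idP => lt.
      by have := high_low_diff Hk' lt bk' => e; apply/highP; exists a; lia.
    by have := high_low_diff Hk lt ak => e; apply/highP; exists b; lia.
  have bb : (l \in low k') = (l \in low k).
    apply/idP/idP => lb.
      by have := high_low_diff Hk' ak' lb => e; apply/lowP; exists b; lia.
    by have := high_low_diff Hk bk lb => e; apply/lowP; exists a; lia.
  by rewrite tt bb zl subrr.
split.
- by apply: eq_from_tnth => l; rewrite tnth_mktuple zE (mem l).1.
- have : \sum_l ((l \in high k')%:R - (l \in high k)%:R) = 0 :> int.
    by rewrite -[RHS]z0; apply: eq_bigr => l _; have [->] := mem l.
  by rewrite sumrB !sum_mem => /eqP; rewrite subr_eq0 eqz_nat => /eqP.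
- by apply/setP => l; have [] := mem l.
Qed.

(** When there are high coordinates, the values of [rehigh k A] stay between the
low and the high value of k; the high one is reached on [A] only, and the low one
is reached because [A] does not exhaust the extremal positions. *)
Lemma rehighP k A : HHstar k -> A \subset extremal k -> #|A| = #|high k| ->
  HHstar (rehigh k A) /\ high (rehigh k A) = A.
Proof.
move=> Hk AU cA; have [Hk1 h] := (HHstarE k).1 Hk.
have Hr : HH (rehigh k A).
  by apply: HH_addM => //; rewrite sumrB !sum_mem cA subrr.
have [t0|/set0Pn[b bt]] := eqVneq (high k) finset.set0.
  have -> : A = finset.set0 by apply/eqP; rewrite -cards_eq0 cA t0 cards0.
  have -> : rehigh k finset.set0 = k; last by [].
  by apply: eq_from_tnth => l; rewrite tnth_mktuple t0 !inE subrr mulr0 addr0.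
have /highP[a ba] := bt; have ab : a \in low k by apply/lowP; exists b.
have rE l : tnth (rehigh k A) l =
    if l \in A then tnth k b else if l \in extremal k then tnth k a else tnth k l.
  rewrite tnth_mktuple in_extremal; case: ifPn => lA.
    have := fintype.subsetP AU _ lA; rewrite in_extremal.
    have [lt _|lt /= lb] := boolP (l \in high k).
      by rewrite subrr mulr0 addr0; have := high_low_diff Hk lt ab; lia.
    by rewrite subr0 mulr1; have := high_low_diff Hk bt lb; lia.
  have [lt|lt] := boolP (l \in high k); rewrite /=.
    by rewrite sub0r mulrN1; have := high_low_diff Hk lt ab; lia.
  rewrite subrr mulr0 addr0; case: ifPn => // lb.
  by have := high_low_diff Hk bt lb; lia.
have range l : tnth k a <= tnth (rehigh k A) l <= tnth k b.
  rewrite rE; have := h l a; have := h b l; have := h b a; rewrite ba.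
  by case: ifP => _; [|case: ifP => _]; lia.
have outside l : l \notin A -> tnth (rehigh k A) l < tnth k b.
  move=> lA; rewrite rE (negbTE lA); case: ifPn => lU; first by have := M0; lia.
  have := h l a; rewrite le_eqVlt => /predU1P[la|]; last by lia.
  by case/negP: lU; rewrite in_extremal; apply/orP; left; apply/highP; exists a.
(* a low coordinate exists, so A, of the size of high k, misses some position *)
have [c cU cA'] : exists2 c, c \in extremal k & c \notin A.
  apply/fintype.subsetPn; apply/negP => UA.
  have := subset_leq_card UA; rewrite cA card_extremal//.
  have : (0 < #|low k|)%N by apply/card_gt0P; exists a.
  by lia.
split.
  apply/HHstarE; split=> // i j.
  by have := range i; have := range j; lia.
apply/setP => l; apply/highP/idP => [[m lm]|lA].
  apply: contraT => /outside; have := range m; lia.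
by exists c; rewrite !rE lA (negbTE cA') cU.
Qed.

(** The set of high coordinates parametrizes the class of k in [HHstar]. *)
Lemma perm_fibre k : HHstar k ->
  perm_eq [seq k' <- fset_set HHstar | congM k k']
    [seq rehigh k A | A <- enum (finset (fun A : {set 'I_d.+1} =>
       (A \subset extremal k) && (#|A| == #|high k|)))].
Proof.
move=> Hk; apply: uniq_perm; first by rewrite filter_uniq// fset_uniq.
- rewrite map_inj_in_uniq ?enum_uniq// => A B.
  rewrite !mem_enum !inE => /andP[AU /eqP cA] /andP[BU /eqP cB] AB.
  by rewrite -(rehighP Hk AU cA).2 AB (rehighP Hk BU cB).2.
- move=> k'; rewrite mem_filter in_fset_set; last exact: finite_HHstar.
  apply/andP/mapP => [[c /set_mem Hk']|[A]].
    have [k'E ct cU] := fibre_high Hk Hk' c; exists (high k') => //.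
    by rewrite mem_enum inE -cU high_sub_extremal ct eqxx.
  move=> Aen ->; have /andP[AU /eqP cA] : (A \subset extremal k) && (#|A| == #|high k|).
    by move: Aen; rewrite mem_enum inE.
  split; first exact: congM_rehigh.
  by apply/mem_set; have [] := rehighP Hk AU cA.
Qed.

Lemma sum_weight_fibre k : HHstar k ->
  \sum_(k' <- fset_set HHstar | congM k k') weight R n k' = 1.
Proof.
move=> Hk; pose U := extremal k.
have wE k' : k' \in fset_set HHstar -> congM k k' ->
    weight R n k' = ('C(#|U|, #|high k|)%:R)^-1.
  rewrite in_fset_set; last exact: finite_HHstar.
  move=> /set_mem Hk' c; have [_ ct cU] := fibre_high Hk Hk' c.
  by rewrite weight_star// cU ct.
rewrite big_seq_cond (eq_bigr (fun=> ('C(#|U|, #|high k|)%:R)^-1)); last first.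
  by move=> k' /andP[]; exact: wE.
rewrite -big_seq_cond -big_filter (perm_big _ (perm_fibre Hk)) /= big_map big_enum /=.
rewrite sumr_const cards_draws -[_^-1 *+ _]mulr_natr mulVf// pnatr_eq0 -lt0n bin_gt0.
exact/subset_leq_card/high_sub_extremal.
Qed.

Lemma HHn_star k : HHn k -> HHstar k.
Proof. by move=> [Hk h]; split=> // i j ij; have /andP[/ltW -> ->] := h _ _ ij. Qed.

(** Each term of the left side is charged to the representative in [HHn] of its
class. *)
Lemma sum_star (F : d.+1.-tuple int -> R[i]) :
  (forall k k', HH k -> HH k' -> congM k k' -> F k' = F k) ->
  \sum_(k \in HHstar) (weight R n k)%:C * F k = \sum_(k \in HHn) F k.
Proof.
move=> Fper; have fn := finite_HHn R d n; have fs := finite_HHstar R d n.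
rewrite !fsbig_finite//=.
transitivity (\sum_(k <- fset_set HHstar) \sum_(j <- fset_set HHn | congM j k)
    (weight R n k)%:C * F j).
  rewrite big_seq [RHS]big_seq; apply: eq_bigr => k; rewrite in_fset_set// => /set_mem Hk.
  have [Hr c] := repP Hk.1.
  rewrite -big_filter (bigD1_seq (rep k))/=; first last.
  - by rewrite filter_uniq// fset_uniq.
  - by rewrite mem_filter congM_sym c/= in_fset_set//; exact/mem_set.
  rewrite big_seq_cond big1 ?addr0; first by rewrite (Fper _ _ Hk.1 Hr.1 c).
  move=> j; rewrite mem_filter in_fset_set// => /andP[/andP[jk /set_mem Hj]] /eqP[].
  by apply/esym; apply: rep_eq => //; [exact: Hk.1|rewrite congM_sym].
rewrite (exchange_big_dep xpredT)//=.
rewrite big_seq [RHS]big_seq; apply: eq_bigr => j; rewrite in_fset_set// => /set_mem Hj.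
rewrite -mulr_suml -[RHS]mul1r; congr (_ * _).
by rewrite -rmorph_sum sum_weight_fibre//; exact: HHn_star.
Qed.


(** * Expansion of the three forms *)

Let s := fset_set HHn.

Lemma mem_HHn_seq k : k \in s -> HHn k.
Proof. by rewrite in_fset_set; [move/set_mem|exact: finite_HHn]. Qed.

Lemma ksub_eq0 k m : [forall i, tnth (ksub k m) i == 0] = (k == m).
Proof.
apply/forallP/eqP => [h|-> i]; last by rewrite tnth_mktuple subrr.
by apply: eq_from_tnth => i; have := h i; rewrite tnth_mktuple subr_eq0 => /eqP.
Qed.

Lemma mean_HHn_phi k m : (0 < d)%N -> HHn k -> HHn m ->
  (d.+1 * n ^ d)%:R^-1 * \sum_(j \in HHn) phi (ksub k m) (node j) =
  (k == m)%:R :> R[i].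
Proof.
move=> d0 Hk Hm; have [<-|km] := eqVneq k m; last first.
  by rewrite sum_HHn_phi_eq0// mulr0.
rewrite (eq_fsbigr (fun=> 1)) => [|j _]; last first.
  by rewrite phiE phase_ksub subrr cos0 sin0.
rewrite fsbig_finite; last exact: finite_HHn.
rewrite big_const_seq count_predT iter_addr_0 size_HHn// mulVf//.
by rewrite pnatr_eq0 -lt0n muln_gt0 expn_gt0 n0.
Qed.

(** The values of f and g off the hyperplane are arbitrary, so the product is only
expanded there. *)
Lemma HHspan_mul f g : HHspan R d n f -> HHspan R d n g ->
  exists c : d.+1.-tuple int -> d.+1.-tuple int -> R[i], forall t, RH R d t ->
    f t * (g t)^* = \sum_(k <- s) \sum_(m <- s) c k m * phi (ksub k m) t.
Proof.
move=> [a fE] [b gE]; exists (fun k m => a k * (b m)^*) => t Ht.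
rewrite fE// gE// !fsbig_finite; [|exact: finite_HHn..].
rewrite rmorph_sum mulr_suml; apply: eq_bigr => k _.
rewrite mulr_sumr; apply: eq_bigr => m _.
by rewrite phi_ksub rmorphM; ring.
Qed.

Lemma mean_OmegaH_double_sum (c : d.+1.-tuple int -> d.+1.-tuple int -> R[i]) :
  ((Num.sqrt d.+1%:R)^-1)%:C * cintegral (surface R d) (@OmegaH R d)
    (fun t => \sum_(k <- s) \sum_(m <- s) c k m * phi (ksub k m) t) =
  \sum_(k <- s) \sum_(m <- s) c k m * (k == m)%:R.
Proof.
have mO := @measurable_OmegaH R d.
have iphi k m : cintegrable (surface R d) (@OmegaH R d)
      (fun t => c k m * phi (ksub k m) t).
  by apply: cintegrableZ => //; exact: cintegrable_phi.
rewrite cintegral_sum//; last by move=> k; exact: cintegrable_sum.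
rewrite mulr_sumr big_seq [RHS]big_seq; apply: eq_bigr => k /mem_HHn_seq Hk.
rewrite cintegral_sum// mulr_sumr big_seq [RHS]big_seq.
apply: eq_bigr => m /mem_HHn_seq Hm.
rewrite cintegralZ//; last exact: cintegrable_phi.
by rewrite mulrCA mean_OmegaH_phi ?ksub_eq0//; exact: HH_ksub Hk.1 Hm.1.
Qed.

Lemma mean_HHn_double_sum (c : d.+1.-tuple int -> d.+1.-tuple int -> R[i]) : (0 < d)%N ->
  (d.+1 * n ^ d)%:R^-1 * \sum_(j \in HHn)
    (\sum_(k <- s) \sum_(m <- s) c k m * phi (ksub k m) (node j)) =
  \sum_(k <- s) \sum_(m <- s) c k m * (k == m)%:R.
Proof.
move=> d0; rewrite fsbig_finite; last exact: finite_HHn.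
rewrite exchange_big mulr_sumr /= big_seq [RHS]big_seq.
apply: eq_bigr => k /mem_HHn_seq Hk.
rewrite exchange_big mulr_sumr /= big_seq [RHS]big_seq.
apply: eq_bigr => m /mem_HHn_seq Hm.
rewrite -mulr_sumr mulrCA -mean_HHn_phi// fsbig_finite//; exact: finite_HHn.
Qed.

End discrete.

Theorem theorem3p17 (R : realType) (d n : nat) (hd : (1 <= d)%N) (hn : (1 <= n)%N)
    (f g : Rn R d.+1 -> R[i]) :
  HHspan R d n f -> HHspan R d n g ->
  ip f g = ipn n f g /\ ipn n f g = ipn_star n f g.
Proof.
move=> Hf Hg; have [c fgE] := HHspan_mul Hf Hg.
pose F t := \sum_(k <- fset_set (@HHn R d n)) \sum_(m <- fset_set (@HHn R d n))
  c k m * phi (ksub k m) t.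
have ipnE : ipn n f g =
    (d.+1 * n ^ d)%:R^-1 * \sum_(j \in @HHn R d n) F (node R n j).
  congr (_ * _); apply: eq_fsbigr => j /set_mem Hj; apply: fgE.
  exact: RH_node Hj.1.
split.
  rewrite ipnE mean_HHn_double_sum// -mean_OmegaH_double_sum; congr (_ * _).
  by apply: eq_cintegral => t /set_mem[Ht _]; exact: fgE.
rewrite ipnE; congr (_ * _); rewrite -sum_star//.
  apply: eq_fsbigr => j /set_mem Hj; rewrite -mulrA; congr (_ * _).
  by apply/esym/fgE/RH_node; case: Hj.
move=> k k' Hk Hk' kk'; rewrite /F big_seq [RHS]big_seq.
apply: eq_bigr => q /mem_HHn_seq Hq; rewrite big_seq [RHS]big_seq.
apply: eq_bigr => m /mem_HHn_seq Hm.
by rewrite (phi_node_congM R hn (HH_ksub Hq.1 Hm.1) Hk Hk' kk').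
Qed.
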